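(* Assume that the summability exponent of the sequence $\boldsymbol b$ satisfies $p\in(0,\min\{\frac23,\frac1\beta\}]$, $p\ne\frac1\beta$, and fix $\boldsymbol\xi\in\Xi$. Let $\delta>0$ be arbitrary. Then, for $\ell=0,1,2,\dots$, generating vectors can be constructed by the component-by-component (CBC) algorithm such that the full tensor product approximation $Q^{(1)}_{\ell}g(Q^{(2)}_{\ell}f)$ (same level $\ell$ for the inner and outer rule) of the double integral $$ \mathcal I_K=\int_{[-K,K]^k}g\bigg(\int_{\Theta_s}f(\boldsymbol\theta,\boldsymbol y)\,{\rm d}\boldsymbol\theta\bigg){\rm d}\boldsymbol y $$ satisfies $$ \sqrt{\mathbb E\big[|\mathcal I_K-Q^{(1)}_\ell g(Q^{(2)}_\ell f)|^2\big]}\le C'\,(2^\ell)^{-\frac12+\delta}\quad\text{for all }\ell\ge0, $$ where $C'>0$ is a constant (independent of $\ell$) and the expectation is over the random shifts.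
   Context: Notation: $g(x)=x\log x$; $f(\boldsymbol\theta,\boldsymbol y)=C_{k,\Gamma}{\rm e}^{-\frac12\|\boldsymbol y-G_s(\boldsymbol\theta,\boldsymbol\xi)\|_{\Gamma^{-1}}^2}$, $C_{k,\Gamma}=(\det(2\pi\Gamma))^{-1/2}$, $\|\boldsymbol x\|_{\Gamma^{-1}}=\sqrt{\boldsymbol x^{\rm T}\Gamma^{-1}\boldsymbol x}$; $\|\cdot\|$ is the Euclidean norm; $|\boldsymbol\nu|=\sum_j\nu_j$, $\boldsymbol b^{\boldsymbol\nu}=\prod_jb_j^{\nu_j}$. Standing assumptions: $k,s\in\mathbb N$, $K>0$; $\Xi$ is a compact subset of a Euclidean space; $\Theta_s=[-\frac12,\frac12]^s$. $\Gamma\in\mathbb R^{k\times k}$ is symmetric positive definite and $0<\mu_{\min}\le1$ is a lower bound on its smallest eigenvalue. $C\ge1$, $\beta\ge1$ are constants and $\boldsymbol b=(b_j)_{j\ge1}\in\ell^p(\mathbb N)$, $p\in(0,1)$, is a sequence of nonnegative reals, all independent of $s$ and $\boldsymbol\xi$. The forward models $G_s:\Theta_s\times\Xi\to\mathbb R^k$ are smooth in $\boldsymbol\theta$ and satisfy $\|\partial^{\boldsymbol\nu}_{\boldsymbol\theta}G_s(\boldsymbol\theta,\boldsymbol\xi)\|\le C(|\boldsymbol\nu|!)^\beta\boldsymbol b^{\boldsymbol\nu}$ for all $\boldsymbol\theta\in\Theta_s$, $\boldsymbol\nu\in\mathbb N_0^s$, $\boldsymbol\xi\in\Xi$. Cubature: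 $Q^{(1)}_\ell F=(2K)^k2^{-\ell}\sum_{i=1}^{2^\ell}F\big(2K\{i\boldsymbol z/2^\ell+\boldsymbol\Delta\}-K\mathbf 1\big)$, with $\boldsymbol z\in\mathbb N^k$ a generating vector, $\{\cdot\}$ the componentwise fractional part, $\boldsymbol\Delta\sim\mathcal U([0,1]^k)$; $Q^{(2)}_\ell F=2^{-\ell}\sum_{i=1}^{2^\ell}F\big(\{i\boldsymbol z'/2^\ell+\boldsymbol\Delta'\}-\tfrac12\mathbf 1\big)$ with $\boldsymbol z'\in\mathbb N^s$ and an independent shift $\boldsymbol\Delta'\sim\mathcal U([0,1]^s)$. $Q^{(2)}_\ell$ acts on $\boldsymbol\theta$ for fixed $\boldsymbol y$. CBC algorithm: given positive weights $(\gamma_{\mathfrak u})_{\mathfrak u\subseteq\{1,\dots,d\}}$ and $n=2^m$ points, put $z_1=1$ and for $j=2,\dots,d$ successively choose $z_j\in\{1,\dots,n\}$ coprime to $n$ minimizing, with $z_1,\dots,z_{j-1}$ fixed, the squared shift-averaged worst-case error $\sum_{\varnothing\ne\mathfrak u\subseteq\{1,\dots,j\}}\gamma_{\mathfrak u}\frac1n\sum_{i=1}^n\prod_{l\in\mathfrak u}B_2(\{iz_l/n\})$, $B_2(x)=x^2-x+\frac16$, in the unanchored weighted Sobolev space. *)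

(* Defs.v *)
From HB Require Import structures.
From mathcomp Require Import all_boot all_order all_algebra.
From mathcomp Require Import all_classical all_reals all_analysis.

Set Implicit Arguments.
Unset Strict Implicit.
Unset Printing Implicit Defensive.

Import Order.TTheory GRing.Theory Num.Theory.
Import numFieldNormedType.Exports.

Local Open Scope classical_set_scope.
Local Open Scope ring_scope.

(** The library has the product sigma-algebra on [n.-tuple R] but no product
    measure there; it is obtained from the binary product measure along
    (x, t) |-> x :: t. *)

Section cons_measure.
Context {R : realType} (n : nat).
Variable mu : {sigma_finite_measure set (n.-tuple R) -> \bar R}.

Definition tuple_cons (p : R * n.-tuple R) : n.+1.-tuple R :=
  [the n.+1.-tuple R of p.1 :: p.2].

Lemma measurable_tuple_cons : measurable_fun [set: R * n.-tuple R] tuple_cons.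
Proof. exact: measurable_cons. Qed.

Definition cons_measure : set (n.+1.-tuple R) -> \bar R :=
  pushforward (@lebesgue_measure R \x mu)%E tuple_cons.

Let cons_measure0 : cons_measure set0 = 0%E.
Proof. by rewrite /cons_measure /pushforward preimage_set0 measure0. Qed.

Let cons_measure_ge0 A : (0 <= cons_measure A)%E.
Proof. by rewrite /cons_measure /pushforward; exact: measure_ge0. Qed.

Let cons_measure_sigma_additive : semi_sigma_additive cons_measure.
Proof.
move=> F mF tF mUF; rewrite /cons_measure /pushforward preimage_bigcup.
apply: measure_semi_sigma_additive.
- by move=> m; rewrite -[X in measurable X]setTI;
    apply: measurable_tuple_cons.
- apply/trivIsetP => /= i j _ _ ij; rewrite -preimage_setI.
  by move/trivIsetP : tF => /(_ _ _ _ _ ij) ->//; rewrite preimage_set0.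
- by rewrite -preimage_bigcup -[X in measurable X]setTI;
    apply: measurable_tuple_cons.
Qed.

HB.instance Definition _ := isMeasure.Build _ _ _ cons_measure
  cons_measure0 cons_measure_ge0 cons_measure_sigma_additive.

Let cons_measure_sigma_finite : sigma_finite setT cons_measure.
Proof.
have /sigma_finiteP[F [TF ndF Foo]] := sigma_finiteT (@lebesgue_measure R).
have /sigma_finiteP[H [TH ndH Hoo]] := sigma_finiteT mu.
pose d (t : n.+1.-tuple R) : R * n.-tuple R :=
  (tnth t ord0, [tuple of behead t]).
have md : measurable_fun setT d.
  by apply: measurable_fun_pair; [exact: measurable_tnth|
    exact: measurable_behead].
have dK : d \o tuple_cons = id.
  by apply/funext => -[x t]; rewrite /d /=; congr pair; exact: val_inj.
exists (fun i => d @^-1` (F i `*` H i)).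
  rewrite -preimage_bigcup -[LHS](preimage_setT d); congr (_ @^-1` _).
  rewrite -setXTT TF TH predeqE => -[x y]; split.
    move=> [/= [i _ Fix] [j _ Hjy]]; exists (maxn i j) => //; split.
    - by move: x Fix; exact/subsetPset/ndF/leq_maxl.
    - by move: y Hjy; exact/subsetPset/ndH/leq_maxr.
  by move=> [i _ []/= ? ?]; split; exists i.
move=> i; have [mFi Fi_fin] := Foo i; have [mHi Hi_fin] := Hoo i; split.
  by rewrite -[X in measurable X]setTI; apply: md => //; exact: measurableX.
rewrite /cons_measure /pushforward -comp_preimage dK preimage_id.
by rewrite product_measure1E// lte_mul_pinfty// ge0_fin_numE.
Qed.

HB.instance Definition _ := Measure_isSigmaFinite.Build _ _ _ cons_measure
  cons_measure_sigma_finite.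

End cons_measure.

Fixpoint lebesgue_tuple (R : realType) (n : nat) :
    {sigma_finite_measure set (n.-tuple R) -> \bar R} :=
  match n with
  | 0 => (\d_([tuple] : 0.-tuple R) : {sigma_finite_measure set _ -> \bar R})
  | m.+1 => cons_measure (lebesgue_tuple R m)
  end.

(** Points of R^n are column vectors; tuples are used only as the measurable
    space carrying Lebesgue measure and the laws of the random shifts. *)
Definition col_of_tuple (R : realType) (n : nat) (t : n.-tuple R) : 'cV[R]_n :=
  \col_j tnth t j.

Definition cube (R : realType) (n : nat) (lo hi : R) : set 'cV[R]_n :=
  [set x | forall j, lo <= x j 0 <= hi].

Definition cube_integral (R : realType) (n : nat) (lo hi : R)
    (F : 'cV[R]_n -> R) : R :=
  \int[lebesgue_tuple R n]_(t in @col_of_tuple R n @^-1` cube lo hi)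
    F (col_of_tuple t).

Definition Theta (R : realType) (s : nat) : set 'cV[R]_s :=
  cube (- 2^-1) 2^-1.

Section partial_derivatives.
Context {R : realType} {s k : nat}.
Implicit Types (F : 'cV[R]_s -> 'cV[R]_k) (x : 'cV[R]_s) (j : 'I_s).

Definition diff_quotient F j x (h : R) : 'cV[R]_k :=
  h^-1 *: (F (x + h *: delta_mx j 0) - F x).

(** Increments h <> 0 that stay in the cube, so that the derivative only sees
    F on the cube and is one-sided on its faces. *)
Definition Theta_incr j x : set_system R :=
  within [set h | @Theta R s (x + h *: delta_mx j 0)] 0^'.

Definition Theta_partial j F : 'cV[R]_s -> 'cV[R]_k :=
  fun x => lim (diff_quotient F j x @ Theta_incr j x).

Definition iter_partial (js : seq 'I_s) F : 'cV[R]_s -> 'cV[R]_k :=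
  foldr Theta_partial F js.

Definition Theta_smooth F : Prop :=
  forall js : seq 'I_s,
    {within @Theta R s, continuous (iter_partial js F)} /\
    (forall j x, Theta x ->
       cvg (diff_quotient (iter_partial js F) j x @ Theta_incr j x)).

Definition mpartial (nu : 'I_s -> nat) F : 'cV[R]_s -> 'cV[R]_k :=
  iter_partial (flatten [seq nseq (nu j) j | j <- enum 'I_s]) F.

End partial_derivatives.

(** The norm that the library puts on matrices is the sup norm. *)
Definition enorm (R : realType) (n : nat) (x : 'cV[R]_n) : R :=
  Num.sqrt (\sum_j x j 0 ^+ 2).

Definition mabs (s : nat) (nu : 'I_s -> nat) : nat := (\sum_j nu j)%N.

Definition mpow (R : realType) (s : nat) (b : nat -> R) (nu : 'I_s -> nat) : R :=
  \prod_(j < s) b j ^+ nu j.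

Definition in_lp (R : realType) (p : R) (b : nat -> R) : Prop :=
  cvgn (series (fun j => `|b j| `^ p)).

Definition sym_posdef (R : realType) (k : nat) (Gam : 'M[R]_k) : Prop :=
  Gam^T = Gam /\
  forall x : 'cV[R]_k, x != 0 -> 0 < (x^T *m Gam *m x) 0 0.

Definition inv_norm (R : realType) (k : nat) (Gam : 'M[R]_k) (x : 'cV[R]_k) : R :=
  Num.sqrt ((x^T *m invmx Gam *m x) 0 0).

Definition likelihood (R : realType) (k s : nat) (Gam : 'M[R]_k)
    (G : 'cV[R]_s -> 'cV[R]_k) (theta : 'cV[R]_s) (y : 'cV[R]_k) : R :=
  (\det ((2 * pi) *: Gam)) `^ (- 2^-1)
    * expR (- (2^-1 * inv_norm Gam (y - G theta) ^+ 2)).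

Definition xlogx (R : realType) (x : R) : R := x * ln x.

Definition frac (R : realType) (x : R) : R := x - (Num.floor x)%:~R.

Definition lattice_point (R : realType) (d n : nat) (z : 'I_d -> nat)
    (shift : 'cV[R]_d) (i : nat) : 'cV[R]_d :=
  \col_j frac (i%:R * (z j)%:R / n%:R + shift j 0).

Definition Q1 (R : realType) (k : nat) (K : R) (l : nat) (z : 'I_k -> nat)
    (shift : 'cV[R]_k) (F : 'cV[R]_k -> R) : R :=
  (2 * K) ^+ k * (2 ^+ l)^-1 *
  \sum_(1 <= i < (2 ^ l).+1)
    F ((2 * K) *: lattice_point (2 ^ l) z shift i - const_mx K).

Definition Q2 (R : realType) (s : nat) (l : nat) (z : 'I_s -> nat)
    (shift : 'cV[R]_s) (F : 'cV[R]_s -> R) : R :=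
  (2 ^+ l)^-1 *
  \sum_(1 <= i < (2 ^ l).+1)
    F (lattice_point (2 ^ l) z shift i - const_mx 2^-1).

Definition B2 (R : realType) (x : R) : R := x ^+ 2 - x + 6^-1.

(** Squared shift-averaged worst-case error of the components of index <= j
    (components are numbered from 0). *)
Definition sq_wce (R : realType) (d n : nat) (gam : {set 'I_d} -> R)
    (z : 'I_d -> nat) (j : 'I_d) : R :=
  \sum_(u : {set 'I_d} |
        (u != finset.set0) && (u \subset [pred l : 'I_d | (l <= j)%N]))
    gam u * (n%:R^-1 *
      \sum_(1 <= i < n.+1) \prod_(l in u) B2 (frac (i%:R * (z l)%:R / n%:R))).

Definition admissible (n c : nat) : bool := [&& (1 <= c)%N, (c <= n)%N & coprime c n].

(** Ties between minimizers may be broken arbitrarily. *)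
Definition cbc (R : realType) (d n : nat) (gam : {set 'I_d} -> R)
    (z : 'I_d -> nat) : Prop :=
  (forall j : 'I_d, nat_of_ord j = 0%N -> z j = 1%N) /\
  (forall j : 'I_d, (0 < j)%N ->
     admissible n (z j) /\
     forall c : nat, admissible n c ->
       sq_wce n gam z j <= sq_wce n gam (fun i => if i == j then c else z i) j).

Section shifts.
Context {d : measure_display} {T : measurableType d} {R : realType}.
Variable P : probability T R.

Definition uniform_shift (n : nat) (X : {RV P >-> n.-tuple R}) : Prop :=
  forall A : set (n.-tuple R), measurable A ->
    distribution P X A =
      lebesgue_tuple R n (A `&` @col_of_tuple R n @^-1` cube 0 1).

Definition independent_shifts (m n : nat) (X : {RV P >-> m.-tuple R})
    (Y : {RV P >-> n.-tuple R}) : Prop :=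
  forall (A : set (m.-tuple R)) (B : set (n.-tuple R)),
    measurable A -> measurable B ->
    P (X @^-1` A `&` Y @^-1` B) = (P (X @^-1` A) * P (Y @^-1` B))%E.

End shifts.

(* Main.v *)
(** The proof splits the error as the outer quadrature error of
    [g(I f(., y))] plus the outer rule applied to [g(I f) - g(Q2 f)]. Since [f]
    lies between two positive constants on the cube, [g] is Lipschitz on its
    range, and the second part is bounded by the inner quadrature error,
    uniformly in [y].

    Both quadrature errors are bounded path by path by the norm of the integrand
    times a discrepancy depending only on the shift; hence the two shifts are
    never coupled. With [n = 2^l] points, the grid of mesh [1/n] is used: up to
    [O(1/n)] the integrand is a function on cells, and a shifted lattice point
    lies in the cell [(i z_j + m_j) mod n] where [m_j] is the cell of the shift.
    A tensor-product summation by parts bounds the error by mixed differences of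
    the integrand, and the mean over the cells of the squared discrepancy is at
    most the squared worst-case error with all weights equal to 1.

    For these weights, the mean of [B2({i c / n})] over odd [c] is nonpositive
    unless [n] divides [i]. Averaging over the candidates, a CBC step therefore
    increases [sum_i prod_j (1 + B2({i z_j / n}))] by no more than the increase
    of its [i = 0] term, which is [(7/6)^j / 6], and the squared worst-case error
    is at most [(7/6)^d / n]. *)

Require Import Defs.
From HB Require Import structures.
From mathcomp Require Import all_boot all_order all_algebra.
From mathcomp Require Import all_classical all_reals all_analysis.
From mathcomp Require Import measurable_realfun.
From mathcomp Require Import ring lra zify.

Set Implicit Arguments.
Unset Strict Implicit.
Unset Printing Implicit Defensive.

Import Order.TTheory GRing.Theory Num.Theory.
Import numFieldNormedType.Exports.

Local Open Scope classical_set_scope.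
Local Open Scope ring_scope.

(** * Step functions on a one-dimensional grid *)

(** On the grid, the representation of an integrand by its mixed derivatives becomes a finite
    algebraic identity in mixed differences. Bounds on such differences pass to pointwise limits,
    which is how [g] of the inner integral is reached from grid means of the likelihood. The
    randomness is discretized too: the discrepancy depends only on the cells of the shift, so its
    expectation is at most a finite average. The squared error is never shown to be measurable; only
    the discrepancies that dominate it are. The origin of the step functions is the one-dimensional
    unanchored kernel [1 + \int_0^1 (t - 1_{x<t}) (t - 1_{y<t}) dt], whose average over shifts is
    [1 + B2({x - y})]; the grid version of [t - 1_{x<t}] is used. As [k], [s], [K] and [xi] are
    fixed, constants exponential in the dimension are affordable. *)

Section discrete_basis.
Context {R : realType}.
Implicit Types (n t a b c m x y : nat).

(** For [t > 0] this is minus the indicator of [x < t], centred to have mean 0 over the grid; the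
    index 0 carries the constant function. *)
Definition step_fun n t x : R :=
  if t == 0%N then 1 else t%:R / n%:R - (x < t)%N%:R.

(** The dual functionals, as coefficients of point values: the mean for [t = 0], the backward
    difference at [t] otherwise. Duality with [step_fun] is summation by parts. *)
Definition step_coef n t y : R :=
  if t == 0%N then n%:R^-1 else (y == t)%:R - (y.+1 == t)%:R.

Definition step_weight n t : R := if t == 0%N then 1 else n%:R^-1.

Definition step_kernel n a b : R :=
  \sum_(0 <= t < n) step_weight n t * (step_fun n t a * step_fun n t b).

Lemma sum_nat_delta (F : nat -> R) m n y :
  \sum_(m <= t < n) F t * (y == t)%:R = if (m <= y < n)%N then F y else 0.
Proof.
rewrite -(big_nat1_eq +%R F y m n) [RHS]big_mkcond /=; apply: eq_bigr => t _.
by rewrite eq_sym; case: eqP => _; rewrite ?mulr1 ?mulr0.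
Qed.

Lemma step_fun_coef n x y : (x < n)%N -> (y < n)%N ->
  \sum_(0 <= t < n) step_fun n t x * step_coef n t y = (x == y)%:R.
Proof.
move=> xn yn; have n0 : (0 < n)%N by exact: leq_ltn_trans xn.
have nR : n%:R != 0 :> R by rewrite pnatr_eq0 -lt0n.
pose g t : R := t%:R / n%:R - (x < t)%N%:R.
rewrite big_ltn// {1}/step_fun {1}/step_coef /= mul1r.
(* Only [t = y] and [t = y + 1] contribute. A term missing at either end of the range is harmless
   because [g 0] and [g n] vanish. *)
have -> : \sum_(1 <= t < n) step_fun n t x * step_coef n t y = g y - g y.+1.
  transitivity (\sum_(1 <= t < n) (g t * (y == t)%:R - g t * (y.+1 == t)%:R)).
    apply: eq_big_nat => t /andP[t0 _]; rewrite /step_fun /step_coef.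
    by rewrite gtn_eqF// mulrBr.
  rewrite sumrB !sum_nat_delta yn andbT /= -/(g y.+1); congr (_ - _).
    by case: y yn => // _; rewrite /g /= mul0r subr0.
  case: ifPn => // ; rewrite -leqNgt => ny.
  have -> : y.+1 = n by apply/eqP; rewrite eqn_leq yn.
  by rewrite /g divff// xn subrr.
rewrite /g ltnS (leq_eqVlt x y) -natr1 mulrDl mul1r.
set v : R := n%:R^-1.
have [->|xy] /= := eqVneq x y; first by rewrite ltnn /= mulr0n mulr1n; ring.
by ring.
Qed.

Lemma sum_cst_nat n (x : R) : \sum_(0 <= t < n) x = n%:R * x.
Proof. by rewrite sumr_const_nat subn0 mulr_natl. Qed.

Lemma sum_id n : \sum_(0 <= t < n) t%:R = n%:R * (n%:R - 1) / 2 :> R.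
Proof.
elim: n => [|n IH]; first by rewrite big_nil !mul0r.
by rewrite big_nat_recr//= IH -natr1; field.
Qed.

Lemma sum_sqr n :
  \sum_(0 <= t < n) t%:R ^+ 2 = n%:R * (n%:R - 1) * (2 * n%:R - 1) / 6 :> R.
Proof.
elim: n => [|n IH]; first by rewrite big_nil !mul0r.
by rewrite big_nat_recr//= IH -natr1; field.
Qed.

Lemma sum_gt n a : (a < n)%N ->
  \sum_(0 <= t < n) (a < t)%N%:R = n%:R - 1 - a%:R :> R.
Proof.
elim: n => // n IH; rewrite ltnS leq_eqVlt => /predU1P[->|an].
  rewrite big_nat big1 => [|t /andP[_]]; last first.
    by rewrite ltnS leqNgt => /negbTE ->.
  by rewrite -natr1; ring.
by rewrite big_nat_recr//= IH// an -natr1 mulr1n; ring.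
Qed.

Lemma sum_id_gt n a : (a < n)%N ->
  \sum_(0 <= t < n) t%:R * (a < t)%N%:R =
  (n%:R * (n%:R - 1) - a%:R * (a%:R + 1)) / 2 :> R.
Proof.
elim: n => // n IH; rewrite ltnS leq_eqVlt => /predU1P[->|an].
  rewrite big_nat big1 => [|t /andP[_]]; last first.
    by rewrite ltnS leqNgt => /negbTE ->; rewrite mulr0.
  by rewrite -natr1; ring.
by rewrite big_nat_recr//= IH// an -natr1 mulr1n; field.
Qed.

Lemma step_kernelE n a b : (a < n)%N -> (b < n)%N ->
  step_kernel n a b = 1 + n%:R^-1 * ((n%:R - 1) * (2 * n%:R - 1) / (6 * n%:R)
    + (a%:R * (a%:R + 1) + b%:R * (b%:R + 1)) / (2 * n%:R) - (maxn a b)%:R).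
Proof.
move=> an bn; have n0 : (0 < n)%N by exact: leq_ltn_trans an.
have nR : n%:R != 0 :> R by rewrite pnatr_eq0 -lt0n.
have mn : (maxn a b < n)%N by rewrite gtn_max an.
rewrite /step_kernel big_ltn// {1}/step_weight /step_fun /= !mul1r; congr (_ + _).
transitivity (n%:R^-1 * \sum_(1 <= t < n)
   (t%:R ^+ 2 / n%:R ^+ 2 - t%:R * (a < t)%N%:R / n%:R
     - t%:R * (b < t)%N%:R / n%:R + (maxn a b < t)%N%:R) : R).
  rewrite mulr_sumr; apply: eq_big_nat => t /andP[t0 _].
  rewrite /step_weight gtn_eqF//; congr (_ * _); rewrite gtn_max.
  by case: (a < t)%N; case: (b < t)%N => /=; field.
congr (_ * _).
(* The summand vanishes at [t = 0], so the sum may start there and the closed forms apply. *)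
have := erefl (\sum_(0 <= t < n) (t%:R ^+ 2 / n%:R ^+ 2
     - t%:R * (a < t)%N%:R / n%:R
     - t%:R * (b < t)%N%:R / n%:R + (maxn a b < t)%N%:R) : R).
rewrite {1}big_ltn// !ltn0 !(expr0n, mul0r) !subr0 addr0 add0r => ->.
rewrite big_split /= !sumrB -!mulr_suml sum_sqr !sum_id_gt// sum_gt//.
by field.
Qed.

Lemma sum_periodic_shift (P : nat -> R) n i : (forall r, P (r + n)%N = P r) ->
  \sum_(0 <= r < n) P (i + r)%N = \sum_(0 <= r < n) P r.
Proof.
move=> Pn; elim: i => // i <-.
case: n Pn => [|n] Pn; first by rewrite !big_nil.
rewrite [RHS]big_nat_recl//= big_nat_recr//= addrC addn0; congr (_ + _).
  by rewrite addSnnS Pn.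
by apply: eq_bigr => r _; rewrite addSnnS.
Qed.

Lemma sum_modn (P : nat -> R) n i :
  \sum_(0 <= r < n) P ((i + r) %% n)%N = \sum_(0 <= r < n) P r.
Proof.
rewrite (sum_periodic_shift (P := fun r => P (r %% n)%N)) => [|r].
  by apply: eq_big_nat => r /andP[_ rn]; rewrite modn_small.
by rewrite modnDr.
Qed.

(** The residue of [c + m] exceeds [m] by [c] for the first [n - c] values of [m] and wraps below
    [m] for the others. *)
Lemma sum_max_shift n c : (c < n)%N ->
  \sum_(0 <= m < n) (maxn ((c + m) %% n) m)%:R =
  n%:R * (n%:R - 1) / 2 + c%:R * (n%:R - c%:R) :> R.
Proof.
move=> cn; have cn' := ltnW cn; rewrite -sum_id.
rewrite (big_cat_nat _ (n := n - c)) ?leq_subr//=.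
rewrite [X in _ = X + _](big_cat_nat _ (n := n - c)) ?leq_subr//=.
rewrite addrAC; congr (_ + _); last first.
  apply: eq_big_nat => m /andP[m1 m2]; congr (_%:R).
  have -> : ((c + m) = n + (c + m - n))%N by lia.
  by rewrite modnDl modn_small; lia.
transitivity (\sum_(0 <= m < n - c) (m%:R + c%:R) : R).
  apply: eq_big_nat => m /andP[_ m2]; rewrite -natrD; congr (_%:R).
  by rewrite modn_small; lia.
by rewrite big_split /= sumr_const_nat subn0 -[_ *+ (n - c)]mulr_natr natrB.
Qed.

(** Discrete counterpart of averaging the unanchored kernel over shifts. The last term is the
    discretization error, and its sign is favourable for an upper bound. *)
Lemma step_kernel_mean n c : (c < n)%N ->
  n%:R^-1 * \sum_(0 <= m < n) step_kernel n ((c + m) %% n) m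
  = 1 + B2 (c%:R / n%:R) - (6 * n%:R ^+ 2)^-1 :> R.
Proof.
move=> cn; have n0 : (0 < n)%N by exact: leq_ltn_trans cn.
have nR : n%:R != 0 :> R by rewrite pnatr_eq0 -lt0n.
transitivity (n%:R^-1 * \sum_(0 <= m < n) (1 + n%:R^-1 *
   ((n%:R - 1) * (2 * n%:R - 1) / (6 * n%:R)
    + (((c + m) %% n)%:R * (((c + m) %% n)%:R + 1)
    + m%:R * (m%:R + 1)) / (2 * n%:R) - (maxn ((c + m) %% n) m)%:R)) : R).
  congr (_ * _); apply: eq_big_nat => m /andP[_ mn].
  by rewrite step_kernelE// ltn_mod.
rewrite big_split /= -mulr_sumr sumrB big_split /= !sum_cst_nat.
rewrite -mulr_suml big_split /=.
rewrite (@sum_modn (fun x => x%:R * (x%:R + 1))) sum_max_shift//.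
have -> : \sum_(0 <= i < n) (i%:R * (i%:R + 1)) =
    n%:R * (n%:R - 1) * (2 * n%:R - 1) / 6 + n%:R * (n%:R - 1) / 2 :> R.
  by rewrite -sum_sqr -sum_id -big_split; apply: eq_bigr => i _ /=; ring.
by rewrite /B2; field.
Qed.

End discrete_basis.

(** * Tensor-product discrepancy on the periodic grid *)

Lemma weighted_sum_sqr_le {R : realFieldType} (I : finType) (P : pred I)
    (w q : I -> R) (W : R) :
  0 < W -> (forall i, P i -> 0 <= w i) -> \sum_(i | P i) w i <= W ->
  (\sum_(i | P i) w i * q i) ^+ 2 <= W * \sum_(i | P i) w i * q i ^+ 2.
Proof.
move=> W0 w0 wW; set S := \sum_(i | P i) w i * q i.
set V := \sum_(i | P i) w i * q i ^+ 2.
(* A variance-like sum; as the weights add up to at most [W], expanding it yields the Cauchy-Schwarz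
   bound. *)
have : 0 <= \sum_(i | P i) w i * (q i * W - S) ^+ 2.
  by apply: sumr_ge0 => i Pi; rewrite mulr_ge0 ?w0 ?sqr_ge0.
have -> : \sum_(i | P i) w i * (q i * W - S) ^+ 2 =
    V * W ^+ 2 - S * (2 * S * W) + (\sum_(i | P i) w i) * S ^+ 2.
  transitivity (\sum_(i | P i) (w i * q i ^+ 2 * W ^+ 2
      - w i * q i * (2 * S * W) + w i * S ^+ 2)).
    by apply: eq_bigr => i _; ring.
  by rewrite big_split sumrB -!mulr_suml.
have := ler_wpM2r (sqr_ge0 S) wW => h1 h2.
by rewrite -(ler_pM2l W0) -subr_ge0; nra.
Qed.

Section discrete_cube.
Context {R : realType} (d n : nat).
Hypothesis n0 : (0 < n)%N.
Implicit Types (Phi : ('I_d -> nat) -> R)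
  (x z m : 'I_d -> nat).

Definition zero_index : {ffun 'I_d -> 'I_n} := [ffun=> Ordinal n0].

Lemma nonzero_indexE (t : {ffun 'I_d -> 'I_n}) :
  (t != zero_index) = [exists j, t j != 0%N :> nat].
Proof.
apply/idP/existsP => [tt0|[j]].
  apply/existsP; apply: contraNT tt0; rewrite negb_exists => /forallP h.
  apply/eqP/ffunP => j; apply/val_inj/eqP; rewrite ffunE /=.
  by have := h j; rewrite negbK.
by apply: contraNN => /eqP ->; rewrite ffunE.
Qed.

Definition tensor_coef Phi (t : 'I_d -> nat) : R :=
  \sum_(y : {ffun 'I_d -> 'I_n})
    (\prod_j step_coef n (t j) (y j)) * Phi (fun j => y j).

Definition tensor_fun (t : 'I_d -> nat) x : R := \prod_j step_fun n (t j) (x j).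

Definition tensor_weight (t : 'I_d -> nat) : R := \prod_j step_weight n (t j).

Definition lattice_index z m (i : nat) : 'I_d -> nat :=
  fun j => ((i * z j + m j) %% n)%N.

(** A discrete [L^2] discrepancy: every basis function with a nonzero index has mean 0 over the
    grid, so its lattice average is a quadrature error. *)
Definition lattice_discrepancy z m : R :=
  \sum_(t : {ffun 'I_d -> 'I_n} | [exists j, t j != 0%N :> nat])
    tensor_weight (fun j => t j) *
    (n%:R^-1 * \sum_(0 <= i < n)
       tensor_fun (fun j => t j) (lattice_index z m i)) ^+ 2.

Lemma tensor_expansion Phi x : (forall j, x j < n)%N ->
  Phi x = \sum_(t : {ffun 'I_d -> 'I_n})
    tensor_fun (fun j => t j) x * tensor_coef Phi (fun j => t j).
Proof.
move=> xn; pose X : {ffun 'I_d -> 'I_n} := [ffun j => Ordinal (xn j)].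
have XE : (fun j : 'I_d => X j : nat) = x by apply/funext => j; rewrite ffunE.
under eq_bigr do rewrite mulr_sumr.
rewrite exchange_big /= (bigD1 X)//= [X in _ = _ + X]big1 ?addr0 => [|y yX].
  under eq_bigr do rewrite XE mulrA -big_split /=.
  rewrite -mulr_suml -(bigA_distr_bigA
    (fun j (t : 'I_n) => step_fun n t (x j) * step_coef n t (X j))).
  rewrite big1 ?mul1r// => j _.
  rewrite -(big_mkord predT (fun t => step_fun n t (x j) * step_coef n t (X j))).
  by rewrite step_fun_coef// ffunE /= eqxx.
under eq_bigr do rewrite mulrA -big_split /=.
rewrite -mulr_suml -(bigA_distr_bigA
    (fun j (t : 'I_n) => step_fun n t (x j) * step_coef n t (y j))).
have [j yXj] : exists j, y j != X j.
  by apply/existsP; apply: contraNT yX; rewrite negb_exists => /forallP h;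
    apply/eqP/ffunP => j; apply/eqP; have := h j; rewrite negbK.
rewrite (bigD1 j)//= -(big_mkord predT
  (fun t => step_fun n t (x j) * step_coef n t (y j))) step_fun_coef//.
rewrite -(inj_eq val_inj) ffunE /= eq_sym in yXj.
by rewrite (negbTE yXj) !mul0r.
Qed.

Lemma step_weight_ge0 (t : nat) : 0 <= step_weight n t :> R.
Proof. by rewrite /step_weight; case: ifP. Qed.

Lemma tensor_weight_ge0 (t : 'I_d -> nat) : 0 <= tensor_weight t.
Proof. by apply: prodr_ge0 => j _; exact: step_weight_ge0. Qed.

Lemma lattice_discrepancy_ge0 z m : 0 <= lattice_discrepancy z m.
Proof.
by apply: sumr_ge0 => t _; rewrite mulr_ge0 ?tensor_weight_ge0 ?sqr_ge0.
Qed.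

Lemma sum_step_weight : \sum_(0 <= t < n) step_weight n t <= 2 :> R.
Proof.
rewrite big_ltn// {1}/step_weight /=.
have -> : \sum_(1 <= t < n) step_weight n t = \sum_(1 <= t < n) n%:R^-1 :> R.
  by apply: eq_big_nat => t /andP[t0 _]; rewrite /step_weight gtn_eqF.
rewrite sumr_const_nat -[_ *+ (n - 1)]mulr_natl natrB// mulrBl divff ?pnatr_eq0 -?lt0n//.
have : 0 <= n%:R^-1 :> R by [].
by lra.
Qed.

Lemma lattice_index_lt z m i j : (lattice_index z m i j < n)%N.
Proof. by rewrite ltn_mod. Qed.

(** A Koksma-Hlawka inequality. In the tensor basis the constant term of [Phi] is the grid mean; the
    rest is bounded by Cauchy-Schwarz for the tensor weights, whose total mass is at most [2^d]
    since they sum to at most 2 in each direction. *)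
Lemma koksma_discrete Phi z m (M : R) :
  (forall t : 'I_d -> nat, (forall j, t j < n)%N ->
     `|tensor_coef Phi t| <= M * tensor_weight t) ->
  (n%:R^-1 * (\sum_(0 <= i < n) Phi (lattice_index z m i)) -
   n%:R^-1 ^+ d * \sum_(y : {ffun 'I_d -> 'I_n}) Phi (fun j => y j)) ^+ 2
  <= M ^+ 2 * 2 ^+ d * lattice_discrepancy z m.
Proof.
move=> PhiM.
pose q (t : {ffun 'I_d -> 'I_n}) : R := n%:R^-1 * \sum_(0 <= i < n)
       tensor_fun (fun j => t j) (lattice_index z m i).
have nR : n%:R != 0 :> R by rewrite pnatr_eq0 -lt0n.
have -> : n%:R^-1 * (\sum_(0 <= i < n) Phi (lattice_index z m i)) =
    \sum_(t : {ffun 'I_d -> 'I_n}) q t * tensor_coef Phi (fun j => t j).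
  under eq_bigr do rewrite (tensor_expansion _ (lattice_index_lt z m _)).
  rewrite exchange_big mulr_sumr; apply: eq_bigr => t _.
  by rewrite -mulr_suml mulrA.
rewrite (bigD1 zero_index)//=.
have -> : q zero_index = 1.
  rewrite /q; under eq_bigr => i _.
    rewrite /tensor_fun big1 => [|j _]; last by rewrite ffunE.
    over.
  by rewrite sumr_const_nat subn0 -mulr_natr mul1r mulVf.
have -> : tensor_coef Phi (fun j => zero_index j) =
    n%:R^-1 ^+ d * \sum_(y : {ffun 'I_d -> 'I_n}) Phi (fun j => y j).
  rewrite mulr_sumr; apply: eq_bigr => y _; congr (_ * _).
  under eq_bigr do rewrite ffunE /step_coef /=.
  by rewrite prodr_const card_ord.
rewrite mul1r addrAC subrr add0r.
under eq_bigl do rewrite nonzero_indexE.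
pose w (t : {ffun 'I_d -> 'I_n}) := tensor_weight (fun j => t j).
have wE : \sum_(t : {ffun 'I_d -> 'I_n} | [exists j, t j != 0%N :> nat]) w t
    <= 2 ^+ d.
  apply: (@le_trans _ _ (\sum_(t : {ffun 'I_d -> 'I_n}) w t)).
    rewrite [leRHS](bigID (fun t : {ffun 'I_d -> 'I_n} =>
      [exists j, t j != 0%N :> nat]))/= lerDl.
    by apply: sumr_ge0 => t _; exact: tensor_weight_ge0.
  rewrite -(bigA_distr_bigA (fun j (t : 'I_n) => step_weight n t)).
  apply: (@le_trans _ _ (\prod_(j < d) 2)).
    apply: ler_prod => j _; rewrite -(big_mkord predT (step_weight n)).
    by rewrite sum_step_weight andbT; apply: sumr_ge0 => t _;
      exact: step_weight_ge0.
  by rewrite prodr_const card_ord.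
rewrite -mulrA; apply: (@le_trans _ _ (M ^+ 2 *
   (\sum_(t : {ffun 'I_d -> 'I_n} | [exists j, t j != 0%N :> nat])
       w t * `|q t|) ^+ 2)).
  rewrite -exprMn mulr_sumr -[leLHS]real_normK ?num_real// lerXn2r ?nnegrE//.
    apply: sumr_ge0 => t _; have tM := PhiM (fun j => t j) (fun j => ltn_ord _).
    rewrite mulrA mulr_ge0//; exact: le_trans tM.
  apply: (le_trans (ler_norm_sum _ _ _)); apply: ler_sum => t _.
  by rewrite normrM mulrC mulrA ler_wpM2r// PhiM.
rewrite ler_wpM2l ?sqr_ge0//.
apply: le_trans (weighted_sum_sqr_le (fun t => `|q t|) _ _ wE) _ => //.
  by move=> t _; exact: tensor_weight_ge0.
rewrite ler_wpM2l//; apply: ler_sum => t _.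
by rewrite real_normK ?num_real.
Qed.

Definition B2_mod (a : nat) : R := B2 ((a %% n)%:R / n%:R).

Lemma B2_ge (x : R) : - (1 / 12) <= B2 x.
Proof.
by rewrite /B2; have := sqr_ge0 (x - 1 / 2); nra.
Qed.

Lemma step_kernel_shift_mean (a b c : nat) :
  n%:R^-1 * \sum_(0 <= m < n) step_kernel n ((c + b + m) %% n) ((b + m) %% n)
  = 1 + B2_mod c - (6 * n%:R ^+ 2)^-1 :> R.
Proof.
rewrite /B2_mod -step_kernel_mean ?ltn_mod//; congr (_ * _).
transitivity (\sum_(0 <= m < n) step_kernel n ((c + m) %% n) (m %% n) : R).
  rewrite -[RHS](@sum_periodic_shift _ _ _ b) => [|r]; last first.
    by rewrite addnA !modnDr.
  by apply: eq_bigr => m _; rewrite addnA.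
apply: eq_big_nat => m /andP[_ mn].
by rewrite modnDml (modn_small mn).
Qed.

(** Expanding the squares gives a double sum of product kernels over pairs of lattice points. The
    average over shift cells factorizes over the directions and depends only on the difference of
    the two indices. *)
Lemma mean_lattice_discrepancy z :
  n%:R^-1 ^+ d * (\sum_(m : {ffun 'I_d -> 'I_n})
    lattice_discrepancy z (fun j => m j))
  <= n%:R^-1 * (\sum_(0 <= r < n) \prod_j (1 + B2_mod (r * z j))) - 1.
Proof.
have nR : n%:R != 0 :> R by rewrite pnatr_eq0 -lt0n.
pose K i i' j : R := n%:R^-1 * \sum_(0 <= m < n)
  step_kernel n ((i * z j + m) %% n) ((i' * z j + m) %% n).
have Kn i i' j : K (i + n)%N i' j = K i i' j.
  rewrite /K; congr (_ * _); apply: eq_bigr => m _.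
  by rewrite mulnDl (mulnC n) -addnA addnCA modnMDl.
have discE m : lattice_discrepancy z m = n%:R^-1 ^+ 2 *
    (\sum_(0 <= i < n) \sum_(0 <= i' < n) \prod_j
      step_kernel n (lattice_index z m i j) (lattice_index z m i' j)) - 1.
  apply/eqP; rewrite -subr_eq opprK; apply/eqP.
  transitivity (\sum_(t : {ffun 'I_d -> 'I_n}) tensor_weight (fun j => t j) *
    (n%:R^-1 * \sum_(0 <= i < n)
       tensor_fun (fun j => t j) (lattice_index z m i)) ^+ 2).
    rewrite (bigD1 zero_index)//= addrC; congr (_ + _); first by
      rewrite /lattice_discrepancy; apply: eq_bigl => t; rewrite nonzero_indexE.
    rewrite /tensor_weight big1 ?mul1r => [|j _]; last by rewrite ffunE.
    under eq_bigr => i _.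
      rewrite /tensor_fun big1 => [|j _]; last by rewrite ffunE.
      over.
    by rewrite sumr_const_nat subn0 -mulr_natr mul1r mulVf// expr1n.
  under eq_bigr do rewrite exprMn mulrCA [in X in _ * X]expr2 mulr_suml.
  rewrite -mulr_sumr; congr (_ * _).
  under eq_bigr do rewrite mulr_sumr.
  rewrite exchange_big /=; apply: eq_bigr => i _.
  under eq_bigr do rewrite !mulr_sumr.
  rewrite exchange_big /=; apply: eq_bigr => i' _.
  under [RHS]eq_bigr do rewrite /step_kernel big_mkord.
  rewrite bigA_distr_bigA /=; apply: eq_bigr => t _.
  by rewrite /tensor_weight /tensor_fun -!big_split.
under eq_bigr do rewrite discE.
rewrite sumrB sumr_const card_ffun !card_ord mulrBr -mulr_natl mulr1 natrX.
rewrite -exprMn mulVf// expr1n lerD2r -mulr_sumr mulrCA.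
have -> : n%:R^-1 ^+ d * (\sum_(m : {ffun 'I_d -> 'I_n})
    \sum_(0 <= i < n) \sum_(0 <= i' < n) \prod_j
      step_kernel n (lattice_index z (fun j => m j) i j)
        (lattice_index z (fun j => m j) i' j)) =
    (* One index is replaced by its offset [r] from the other, which periodicity in the index
       allows. *)
    \sum_(0 <= i < n) \sum_(0 <= r < n) \prod_j K (r + i)%N i j.
  rewrite exchange_big mulr_sumr.
  under eq_bigr do rewrite exchange_big mulr_sumr /=.
  rewrite exchange_big; apply: eq_bigr => i _.
  rewrite -[RHS](@sum_periodic_shift _ _ n 0) ?addn0; last first.
    by move=> r; apply: eq_bigr => j _; rewrite addnAC Kn.
  transitivity (\sum_(0 <= r < n) \prod_j K r i j).
    apply: eq_bigr => i' _.
    rewrite /lattice_index.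
    rewrite -(bigA_distr_bigA (fun j (m : 'I_n) => step_kernel n
      ((i' * z j + m) %% n) ((i * z j + m) %% n))).
    rewrite -[d in n%:R^-1 ^+ d]card_ord -prodr_const -big_split.
    by apply: eq_bigr => j _; rewrite /K big_mkord.
  rewrite -[LHS](@sum_periodic_shift _ _ n i).
    by apply: eq_bigr => r _; rewrite add0n addnC.
  by move=> r; apply: eq_bigr => j _; rewrite Kn.
rewrite exchange_big /= expr2 -mulrA ler_wpM2l// mulr_sumr.
apply: ler_sum_nat => r /andP[_ rn].
under eq_bigr => i _.
  under eq_bigr do rewrite /K mulnDl step_kernel_shift_mean//.
  over.
rewrite sum_cst_nat mulrA mulVf// mul1r.
have n1 : 1 <= n%:R ^+ 2 :> R by rewrite -natrX ler1n expn_gt0 n0.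
have h1 : 0 <= (6 * n%:R ^+ 2)^-1 :> R.
  by rewrite invr_ge0 mulr_ge0// (le_trans ler01).
have h2 : (6 * n%:R ^+ 2)^-1 <= 6^-1 :> R.
  by rewrite lef_pV2 ?posrE//; nra.
(* Dropping [(6 n^2)^-1] in every factor enlarges the product because the factors stay nonnegative:
   [1 - 1/12 - 1/6 > 0]. *)
apply: ler_prod => j _; have := B2_ge ((r * z j %% n)%:R / n%:R).
by rewrite /B2_mod => h3; apply/andP; split; lra.
Qed.

End discrete_cube.

(** * The component-by-component construction *)

Section cbc_bound.
Context {R : realType}.

Lemma frac_natdiv (a n : nat) : (0 < n)%N ->
  Defs.frac (a%:R / n%:R) = (a %% n)%:R / n%:R :> R.
Proof.
move=> n0; have nR : n%:R != 0 :> R by rewrite pnatr_eq0 -lt0n.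
have aE : a%:R / n%:R = (a %/ n)%:R + (a %% n)%:R / n%:R :> R.
  by rewrite {1}(divn_eq a n) natrD natrM mulrDl mulfK.
rewrite /Defs.frac (_ : Num.floor _ = (a %/ n)%:Z); last first.
  apply: floor_def; rewrite aE intrD -!pmulrn lerDl ltrD2l.
  by rewrite divr_ge0//= ltr_pdivrMr ?ltr0n// mul1r ltr_nat ltn_mod n0.
by rewrite {1}aE -pmulrn addrC addKr.
Qed.

Lemma B2_mod_addl n a q : B2_mod n (q * n + a) = B2_mod n a :> R.
Proof. by rewrite /B2_mod modnMDl. Qed.

Lemma B2_mod_double n a : (0 < n)%N -> B2_mod (2 * n) (2 * a) = B2_mod n a :> R.
Proof.
move=> n0; rewrite /B2_mod -muln_modr; congr B2.
by rewrite !natrM -mulf_div divff ?mul1r.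
Qed.

(** The multiplication formula of Bernoulli polynomials, at 0. *)
Lemma sum_B2_mod n : (0 < n)%N ->
  \sum_(0 <= a < n) B2_mod n a = (6 * n%:R)^-1 :> R.
Proof.
move=> n0; have nR : n%:R != 0 :> R by rewrite pnatr_eq0 -lt0n.
transitivity (\sum_(0 <= a < n) (a%:R ^+ 2 / n%:R ^+ 2 - a%:R / n%:R + 6^-1) : R).
  apply: eq_big_nat => a /andP[_ an]; rewrite /B2_mod modn_small// /B2.
  by rewrite expr_div_n.
rewrite big_split sumrB -!mulr_suml sum_sqr sum_id sum_cst_nat.
by rewrite /=; field.
Qed.

(** All residues minus the even ones: with [N = 2^l] the two sums are [1/(12 N)] and [1/(6 N)]. *)
Lemma sum_B2_mod_odd l : \sum_(0 <= c < 2 ^ l) B2_mod (2 ^ l.+1) (2 * c).+1 <= 0 :> R.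
Proof.
have := sum_B2_mod (n := 2 ^ l.+1); rewrite expn_gt0 => /(_ isT).
set f := B2_mod (2 ^ l.+1).
have h N : \sum_(0 <= a < 2 * N) f a = \sum_(0 <= c < N) f (2 * c)%N
    + \sum_(0 <= c < N) f (2 * c).+1.
  elim: N => [|N IH]; first by rewrite muln0 !big_nil addr0.
  by rewrite mulnS !add2n !big_nat_recr//= IH; ring.
rewrite expnS h.
have -> : \sum_(0 <= c < 2 ^ l) f (2 * c)%N = (6 * (2 ^ l)%:R)^-1.
  rewrite -sum_B2_mod ?expn_gt0//; apply: eq_bigr => c _.
  by rewrite /f expnS B2_mod_double ?expn_gt0.
have n0 : 0 < (2 ^ l)%:R :> R by rewrite ltr0n expn_gt0.
rewrite natrM => hE.
have -> : \sum_(0 <= c < 2 ^ l) f (2 * c).+1 =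
   (6 * (2%:R * (2 ^ l)%:R))^-1 - (6 * (2 ^ l)%:R)^-1 by rewrite -hE addrC addKr.
by rewrite subr_le0 lef_pV2 ?posrE; lra.
Qed.

(** Multiplication by an odd number permutes the odd residues modulo [2^(l+1)]; in the proof [s] is
    this permutation, with the residue [2c + 1] indexed by [c]. *)
Lemma sum_odd_multiples (f : nat -> R) l i : odd i ->
  (forall a q, f (q * 2 ^ l.+1 + a)%N = f a) ->
  \sum_(0 <= c < 2 ^ l) f (i * (2 * c).+1)%N =
  \sum_(0 <= c < 2 ^ l) f (2 * c).+1.
Proof.
move=> oi fn; rewrite !big_mkord.
pose r (c : nat) := ((i * (2 * c).+1) %% 2 ^ l.+1)%N.
have rlt c : ((r c)./2 < 2 ^ l)%N.
  rewrite ltn_half_double -mul2n -expnS ltn_mod expn_gt0//.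
have rodd c : ((2 * (r c)./2).+1 = r c)%N.
  rewrite mul2n -[RHS]odd_double_half /r odd_mod ?oddX//.
  by rewrite oddM oi /= mul2n odd_double.
pose s (c : 'I_(2 ^ l)) := Ordinal (rlt c).
have rle (c c' : nat) : (c <= c' < 2 ^ l)%N -> r c = r c' -> c = c'.
  move=> /andP[cc' c'l] /eqP; rewrite eq_sym eqn_mod_dvd; last first.
    by rewrite leq_mul2l ltnS leq_mul2l cc' !orbT.
  rewrite -mulnBr Gauss_dvdr; last by rewrite coprime_pexpl// coprime2n.
  rewrite subSS -mulnBr expnS dvdn_pmul2l// => h.
  apply/eqP; rewrite eqn_leq cc' /= -subn_eq0 eqn0Ngt.
  apply/negP => c0; move: h; rewrite gtnNdvd//.
  by rewrite (leq_ltn_trans (leq_subr _ _)).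
rewrite [RHS](reindex_inj (h := s)) => [|c c' sE].
  apply: eq_bigr => c _; rewrite /= rodd /r [in LHS](divn_eq (i * _) (2 ^ l.+1)).
  exact: fn.
have rcc' : r c = r c' by rewrite -[LHS]rodd -[RHS]rodd; congr (2 * _).+1; exact: (congr1 val sE).
apply: val_inj => /=; case/orP: (leq_total c c') => cc'.
  by apply: rle => //; rewrite cc' ltn_ord.
by apply/esym/rle => //; rewrite cc' ltn_ord.
Qed.

(** An odd [i] only permutes the odd residues. An even [i] is halved together with the modulus, and
    the odd residues of the old modulus cover those of the new one twice. *)
Lemma sum_B2_mod_multiples l i : ~~ (2 ^ l.+1 %| i)%N ->
  \sum_(0 <= c < 2 ^ l) B2_mod (2 ^ l.+1) (i * (2 * c).+1) <= 0 :> R.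
Proof.
have [oi _|] := boolP (odd i).
  rewrite (@sum_odd_multiples (B2_mod (2 ^ l.+1)))// => [|a q].
    exact: sum_B2_mod_odd.
  exact: B2_mod_addl.
elim: l i => [|l IH] i ei; first by rewrite expn1 dvdn2 ei.
rewrite -[i](odd_double_half i) (negbTE ei) add0n -mul2n.
set j := i./2; rewrite expnS dvdn_pmul2l// => nj.
under eq_bigr do rewrite -mulnA B2_mod_double ?expn_gt0//.
suff S0 : \sum_(0 <= c < 2 ^ l) B2_mod (2 ^ l.+1) (j * (2 * c).+1) <= 0 :> R.
  have split (N : nat) (f : nat -> R) : \sum_(0 <= c < 2 * N) f c =
      \sum_(0 <= c < N) f c + \sum_(0 <= c < N) f (c + N)%N.
    rewrite mul2n -addnn (big_cat_nat _ (n := N)) ?leq_addr//=.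
    by rewrite -{2}[N]add0n big_addn addnK.
  rewrite [X in \sum_(_ <= _ < X) _]expnS split.
  rewrite [X in _ + X](_ : _ =
    \sum_(0 <= c < 2 ^ l) B2_mod (2 ^ l.+1) (j * (2 * c).+1)).
    by rewrite -mulr2n mulrn_wle0.
  apply: eq_bigr => c _; rewrite -[RHS](B2_mod_addl _ _ j).
  by rewrite expnS -mulnDr mulnDr addnC addnS.
have [oj|ej] := boolP (odd j); last exact: IH.
rewrite (@sum_odd_multiples (B2_mod (2 ^ l.+1)))// => [|a q].
  exact: sum_B2_mod_odd.
exact: B2_mod_addl.
Qed.

Lemma prod_head (d : nat) (F : 'I_d -> R) (j : 'I_d) :
  \prod_(l < d | (l <= j)%N) F l = \prod_(l < d | (l < j)%N) F l * F j.
Proof.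
rewrite (bigD1 j)//= mulrC; congr (_ * _); apply: eq_bigl => l.
by rewrite ltn_neqAle andbC.
Qed.

(** With unit weights the sum over subsets is an expanded product; the [- 1] removes the empty
    set. *)
Lemma sq_wce1E d n (z : 'I_d -> nat) (j : 'I_d) : (0 < n)%N ->
  sq_wce n (fun=> 1) z j = n%:R^-1 *
    (\sum_(0 <= i < n) \prod_(l < d | (l <= j)%N) (1 + B2_mod n (i * z l))) - 1
  :> R.
Proof.
move=> n0; have nR : n%:R != 0 :> R by rewrite pnatr_eq0 -lt0n.
transitivity (n%:R^-1 *
    (\sum_(1 <= i < n.+1) \prod_(l < d | (l <= j)%N) (1 + B2_mod n (i * z l))) - 1
  : R); last first.
  congr (_ * _ - _); rewrite -[RHS](@sum_periodic_shift _ _ n 1) => [|r].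
    by rewrite big_add1 /=; apply: eq_bigr => i _; rewrite add1n.
  by apply: eq_bigr => l _; rewrite mulnDl addnC (mulnC n) B2_mod_addl.
apply/eqP; rewrite -subr_eq opprK; apply/eqP.
rewrite /sq_wce.
transitivity (\sum_(u : {set 'I_d} | u \subset [pred l : 'I_d | (l <= j)%N])
  (n%:R^-1 * \sum_(1 <= i < n.+1) \prod_(l in u) B2_mod n (i * z l)) : R).
  rewrite [RHS](bigD1 finset.set0)/=; last by apply/fintype.subsetP => x; rewrite finset.in_set0.
  rewrite [LHS]addrC; congr (_ + _).
    under eq_bigr do rewrite big_set0.
    by rewrite sumr_const_nat subn1 /= -[_ *+ n]mulr_natr mul1r mulVf.
  apply: eq_big => [u|u _]; first by rewrite andbC.
  rewrite mul1r; congr (_ * _); apply: eq_bigr => i _.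
  by apply: eq_bigr => l _; rewrite -natrM frac_natdiv.
rewrite -mulr_sumr; congr (_ * _); rewrite exchange_big /=.
apply: eq_bigr => i _.
rewrite [RHS]big_mkcond /=.
under [RHS]eq_bigr => l _.
  rewrite (_ : (if (l <= j)%N then _ else _) =
    (if (l <= j)%N then B2_mod n (i * z l) else 0) + 1); last first.
    by case: ifP => _; rewrite ?add0r// addrC.
  over.
rewrite bigA_distr big_mkcond /=; apply: eq_bigr => u _.
case: ifPn => [/fintype.subsetP uj|/fintype.subsetPn[l lu]].
  rewrite [RHS](bigID (fun l => l \in u)) /= [X in _ = _ * X]big1 ?mulr1; last first.
    by move=> l lu; rewrite (negbTE lu).
  by apply: eq_bigr => l lu; rewrite lu; have := uj _ lu; rewrite inE => ->.
by rewrite inE => lj; rewrite (bigD1 l)//= lu (negbTE lj) mul0r.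
Qed.

Lemma cbc_ext d n (gam : {set 'I_d} -> R) (z z' : 'I_d -> nat) (j : 'I_d) :
  (forall l : 'I_d, (l <= j)%N -> z l = z' l) ->
  sq_wce n gam z j = sq_wce n gam z' j.
Proof.
move=> zz'; apply: eq_bigr => u /andP[_ /fintype.subsetP uj].
congr (_ * (_ * _)); apply: eq_bigr => i _; apply: eq_bigr => l lu.
by rewrite zz'//; have := uj _ lu; rewrite inE.
Qed.

Lemma cbc_exists d n (gam : {set 'I_d} -> R) : (0 < n)%N ->
  exists z : 'I_d -> nat, cbc n gam z.
Proof.
move=> n0.
suff /(_ d)[z [z0 hz]] : forall m, exists z : 'I_d -> nat,
    (forall j : 'I_d, nat_of_ord j = 0%N -> z j = 1%N) /\
    (forall j : 'I_d, (j < m)%N -> (0 < j)%N -> admissible n (z j) /\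
     forall c : nat, admissible n c ->
       sq_wce n gam z j <= sq_wce n gam (fun i => if i == j then c else z i) j).
  by exists z; split=> // j; apply: hz.
elim=> [|m [z [z0 hz]]]; first by exists (fun=> 1%N).
have [dm|md] := leqP d m.
  by exists z; split=> // j _; apply: hz; exact: leq_trans (ltn_ord j) dm.
pose j0 := Ordinal md.
(* Component 0 is prescribed, so there is nothing to minimize. *)
have [m0|m0] := posnP m.
  by exists z; split=> // j; rewrite ltnS m0; case: (nat_of_ord j).
pose F (c : 'I_n.+1) := sq_wce n gam (fun i => if i == j0 then c : nat else z i) j0.
have P1 : admissible n (inord 1 : 'I_n.+1).
  by rewrite /admissible inordK// n0 coprime1n.
case: (@Order.TotalTheory.arg_minP _ _ _ (inord 1)
  (fun c : 'I_n.+1 => admissible n c) F P1) => c adc cmin.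
exists (fun i => if i == j0 then c : nat else z i); split=> [j j0E|j].
  case: eqP => [jj0|_]; last exact: z0.
  by move: m0; rewrite -j0E jj0 /= ltnn.
rewrite ltnS leq_eqVlt => /predU1P[jm|jm] jpos.
  have -> : j = j0 by exact: val_inj.
  rewrite eqxx; split=> // c' adc'.
  have c'n : (c' < n.+1)%N by case/and3P: adc'.
  have := cmin (Ordinal c'n) adc'; rewrite /F => /le_trans; apply.
  by rewrite le_eqVlt; apply/orP; left; apply/eqP; apply: cbc_ext => l _ /=;
    case: eqP.
have [h1 h2] := hz _ jm jpos.
have jj0 : (j == j0) = false by apply/eqP => /(congr1 val) /= jE; rewrite jE ltnn in jm.
rewrite jj0; split=> // c' adc'.
rewrite (@cbc_ext _ _ _ _ z) => [|l lj]; last first.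
  by case: eqP => // lE; move: lj; rewrite lE /= leqNgt jm.
apply: le_trans (h2 _ adc') _.
rewrite le_eqVlt; apply/orP; left; apply/eqP; apply: cbc_ext => l lj /=.
by case: eqP => // _; case: eqP => // lE; move: lj; rewrite lE /= leqNgt jm.
Qed.

Lemma cbc_bound d l (z : 'I_d -> nat) : cbc (2 ^ l) (fun=> 1 : R) z ->
  forall j : 'I_d, sq_wce (2 ^ l) (fun=> 1) z j <= (7 / 6 : R) ^+ j.+1 / (2 ^ l)%:R.
Proof.
move=> [z1 zmin] j; set n := (2 ^ l)%N.
have n0 : (0 < n)%N by rewrite expn_gt0.
have n0R : 0 < n%:R :> R by rewrite ltr0n.
have nR : n%:R != 0 :> R by rewrite pnatr_eq0 -lt0n.
pose Q (w : 'I_d -> nat) (j : 'I_d) i : R :=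
  \prod_(k < d | (k <= j)%N) (1 + B2_mod n (i * w k)).
pose Pj (j : 'I_d) i : R := \prod_(k < d | (k < j)%N) (1 + B2_mod n (i * z k)).
have B1 i c : 0 <= 1 + B2_mod n (i * c) :> R.
  by have := B2_ge (((i * c) %% n)%:R / n%:R : R); rewrite /B2_mod; lra.
have Pj_ge0 k i : 0 <= Pj k i by apply: prodr_ge0 => ? _; exact: B1.
(* With this form the induction closes exactly: a step adds at most [(7/6)^j / 6], one sixth of the
   power already reached. *)
suff : \sum_(0 <= i < n) Q z j i <= n%:R - 1 + (7 / 6) ^+ j.+1.
  move=> h; rewrite sq_wce1E// lerBlDr ler_pdivrMl//.
  rewrite mulrDr mulrCA divff// !mulr1 (le_trans h)//; lra.
pose A m := forall j : 'I_d, nat_of_ord j = m ->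
  \sum_(0 <= i < n) Q z j i <= n%:R - 1 + (7 / 6) ^+ j.+1.
suff : forall m, A m by move/(_ j); apply.
move=> {j}; elim=> [|m IH] j jE.
  have -> : \sum_(0 <= i < n) Q z j i = \sum_(0 <= i < n) (1 + B2_mod n i).
    apply: eq_bigr => i _.
    rewrite /Q (bigD1 j)//= big1 ?mulr1 ?z1// ?muln1//= => k.
    by rewrite jE leqn0 => /andP[/eqP k0]; rewrite -(inj_eq val_inj) /= jE k0.
  rewrite big_split /= sum_cst_nat mulr1 sum_B2_mod// jE expr1.
  have n1 : 1 <= n%:R :> R by rewrite ler1n.
  have : (6 * n%:R)^-1 <= 6^-1 :> R by rewrite lef_pV2 ?posrE; lra.
  lra.
have jd : (m < d)%N by apply: leq_ltn_trans (ltn_ord j); rewrite jE.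
have j0 : (0 < j)%N by rewrite jE.
have IHm := IH (Ordinal jd) erefl.
have PjE i : Pj j i = Q z (Ordinal jd) i.
  by apply: eq_bigl => k; rewrite jE ltnS.
have QE w i : (forall k : 'I_d, (k < j)%N -> w k = z k) ->
    Q w j i = Pj j i + Pj j i * B2_mod n (i * w j).
  move=> wz; rewrite /Q prod_head mulrDr mulr1 /Pj.
  by congr (_ + _ * _); apply: eq_bigr => k kj; rewrite wz.
have Pj0 : Pj j 0%N = (7 / 6) ^+ j.
  rewrite /Pj; under eq_bigr do rewrite mul0n.
  have -> : 1 + B2_mod n 0 = 7 / 6 :> R.
    by rewrite /B2_mod mod0n mul0r /B2; lra.
  rewrite -(big_ord_widen d (fun=> 7 / 6)); last exact: ltnW.
  by rewrite prodr_const card_ord.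
(* The number of odd candidates in [1..n]. For [l = 0] the truncated predecessor gives [N = 1], with
   1 as the only candidate. *)
pose N := (2 ^ l.-1)%N.
have adm c : (c < N)%N -> admissible n (2 * c).+1.
  rewrite /N /n /admissible; case: l {n n0 n0R nR z1 zmin Q Pj B1 Pj_ge0 A IH IHm PjE QE Pj0 N} => [|l] cN.
    by move: cN; rewrite expn0; case: c.
  rewrite /= coprimeXr ?andbT; last by rewrite coprimen2 /= mul2n odd_double.
  by rewrite /= in cN; rewrite expnS; lia.
have key c : (c < N)%N -> \sum_(0 <= i < n) Pj j i * B2_mod n (i * z j) <=
    \sum_(0 <= i < n) Pj j i * B2_mod n (i * (2 * c).+1).
  move=> cN; have [_ /(_ _ (adm _ cN))] := zmin _ j0.
  rewrite !sq_wce1E// lerD2r ler_pM2l ?invr_gt0//.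
  rewrite -/(Q z j _).
  under eq_bigr do rewrite -/(Q z j _) QE//.
  rewrite [X in _ <= X](eq_bigr (fun i =>
    Pj j i + Pj j i * B2_mod n (i * (2 * c).+1))) => [|i _].
    by rewrite !big_split /= lerD2l.
  have := QE (fun k => if k == j then (2 * c).+1 else z k) i.
  rewrite eqxx; apply => k kj; case: eqP => // kj'.
  by rewrite kj' ltnn in kj.
have N0 : 0 < N%:R :> R by rewrite ltr0n expn_gt0.
have : N%:R * (\sum_(0 <= i < n) Pj j i * B2_mod n (i * z j)) <=
    N%:R * ((7 / 6) ^+ j / 6).
  apply: (@le_trans _ _ (\sum_(0 <= c < N) \sum_(0 <= i < n)
     Pj j i * B2_mod n (i * (2 * c).+1))).
    rewrite -sum_cst_nat; apply: ler_sum_nat => c /andP[_ cN]; exact: key.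
  rewrite exchange_big /= big_ltn//.
  under eq_bigr do rewrite mul0n.
  rewrite sum_cst_nat Pj0 /B2_mod mod0n mul0r.
  have -> : B2 0 = 6^-1 :> R by rewrite /B2; lra.
  rewrite gerDl big_nat; apply: sumr_le0 => i /andP[i0 iN].
  rewrite -mulr_sumr mulr_ge0_le0//.
  rewrite /N -/(B2_mod _ _); move: i0 iN; rewrite /n.
  case: l {n n0 n0R nR z1 zmin Q Pj B1 Pj_ge0 A IH IHm PjE QE Pj0 N N0 adm key} => [|l] i0 iN.
    by move: iN; rewrite expn0 ltnS leqNgt i0.
  by apply: sum_B2_mod_multiples; rewrite gtnNdvd.
rewrite ler_pM2l// => key2.
under eq_bigr do rewrite QE//.
rewrite big_split /=.
under eq_bigr do rewrite PjE.
rewrite jE in key2 *; rewrite [in leRHS]exprS.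
by apply: le_trans (lerD IHm key2) _; rewrite /= ; lra.
Qed.

End cbc_bound.

(** * Bounded mixed derivatives *)

Section segment_derivative.
Context {R : realType} (lo hi : R).
Implicit Types phi psi : R -> R.

(** Just what the mean value theorem asks for. It suits partial derivatives that are one-sided on
    the faces of the cube. *)
Definition segment_derive phi phi' : Prop :=
  (forall v, lo <= v <= hi -> phi x @[x --> within `[lo, hi] (nbhs v)] --> phi v) /\
  (forall v, lo < v < hi -> is_derive v 1 phi (phi' v)).

Lemma segment_derive_cst c : segment_derive (fun=> c) (fun=> 0).
Proof. by split=> [v _|v _]; [exact: cvg_cst|exact: is_derive_cst]. Qed.

Lemma segment_derive_id : segment_derive id (fun=> 1).
Proof.
split=> [v _|v _]; last exact: is_derive_id.
exact: cvg_within.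
Qed.

Lemma segment_deriveD phi phi' psi psi' :
  segment_derive phi phi' -> segment_derive psi psi' ->
  segment_derive (fun v => phi v + psi v) (fun v => phi' v + psi' v).
Proof.
move=> [c1 d1] [c2 d2]; split=> v vI; first exact: cvgD (c1 _ vI) (c2 _ vI).
by have := is_deriveD (d1 _ vI) (d2 _ vI).
Qed.

Lemma segment_deriveM phi phi' psi psi' :
  segment_derive phi phi' -> segment_derive psi psi' ->
  segment_derive (fun v => phi v * psi v)
    (fun v => phi' v * psi v + phi v * psi' v).
Proof.
move=> [c1 d1] [c2 d2]; split=> v vI; first exact: cvgM (c1 _ vI) (c2 _ vI).
have := is_deriveM (d1 _ vI) (d2 _ vI) => h.
by apply: (is_derive_eq h); rewrite addrC mulrC.
Qed.

Lemma segment_derive_comp (h h' : R -> R) phi phi' :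
  (forall v, lo <= v <= hi -> is_derive (phi v) 1 h (h' (phi v))) ->
  segment_derive phi phi' ->
  segment_derive (fun v => h (phi v)) (fun v => h' (phi v) * phi' v).
Proof.
move=> dh [c1 d1]; split=> v vI; last first.
  apply: is_derive1_comp; last exact: d1.
  by apply: dh; case/andP: vI => *; rewrite !ltW.
apply: continuous_cvg; last exact: c1.
apply: differentiable_continuous; apply/derivable1_diffP.
by have [] := dh _ vI.
Qed.

Lemma segment_derive_le phi phi' M : segment_derive phi phi' ->
  (forall v, lo <= v <= hi -> `|phi' v| <= M) ->
  forall a b, lo <= a <= hi -> lo <= b <= hi ->
  `|phi b - phi a| <= M * `|b - a|.
Proof.
move=> [c1 d1] dM.
suff le a b : a < b -> lo <= a <= hi -> lo <= b <= hi ->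
    `|phi b - phi a| <= M * `|b - a|.
  move=> a b aI bI; have [ab|ba|->] := ltgtP a b.
  - exact: le.
  - by rewrite distrC (distrC b); exact: le.
  - by rewrite !subrr normr0 mulr0.
move=> ab /andP[la ah] /andP[lb bh].
have sub : `[a, b] `<=` `[lo, hi].
  move=> x /=; rewrite !in_itv /= => /andP[h1 h2].
  by rewrite (le_trans la) //= (le_trans h2).
have cphi : {within `[a, b], continuous phi}.
  apply: (continuous_subspaceW sub).
  apply/subspace_continuousP => x /=; rewrite in_itv /=; exact: c1.
have dab x : x \in `]a, b[ -> is_derive x 1 phi (phi' x).
  rewrite in_itv /= => /andP[ax xb].
  by apply: d1; rewrite (le_lt_trans la) //= (lt_le_trans xb).
have [c] := MVT ab dab cphi.
rewrite in_itv /= => /andP[ac cb] ->; rewrite normrM ler_wpM2r//.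
by apply: dM; apply/andP; split; lra.
Qed.

End segment_derivative.

Definition upd {R : realType} {d : nat} (x : 'cV[R]_d) (j : 'I_d) (v : R) :
  'cV[R]_d := \col_i if i == j then v else x i 0.

Section mixedC1.
Context {R : realType} {d : nat} (lo hi : R).
Implicit Types (js : seq 'I_d) (x : 'cV[R]_d) (P : Type).
Local Notation cube := (@cube R d lo hi).

Lemma updE x j v i : upd x j v i 0 = if i == j then v else x i 0.
Proof. by rewrite mxE. Qed.

Lemma cube_upd x j v : cube x -> lo <= v <= hi -> cube (upd x j v).
Proof. by move=> cx vI i; rewrite updE; case: eqP => // _; exact: cx. Qed.

(** For a family [F] of functions, uniformly in its parameter: all mixed
    derivatives taken once at most in each direction of [js] (the head
    first) exist on the cube and are bounded. *)
Fixpoint mixedC1 js P (F : P -> 'cV[R]_d -> R) : Prop :=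
  match js with
  | [::] => exists M, forall p x, cube x -> `|F p x| <= M
  | j :: js' => mixedC1 js' F /\ exists F' : P -> 'cV[R]_d -> R,
      (forall p x, cube x -> segment_derive lo hi
         (fun v => F p (upd x j v)) (fun v => F' p (upd x j v))) /\
      mixedC1 js' F'
  end.

Lemma mixedC1_bounded js P (F : P -> 'cV[R]_d -> R) : mixedC1 js F ->
  exists2 M, 0 < M & forall p x, cube x -> `|F p x| <= M.
Proof.
elim: js => [|j js IH] /=; last by move=> [/IH].
move=> [M FM]; exists (`|M| + 1) => [|p x cx]; first by rewrite ltr_wpDl.
by rewrite (le_trans (FM p x cx))// (le_trans (ler_norm M))// lerDl.
Qed.

Lemma mixedC1_reindex js P Q (s : Q -> P) (F : P -> 'cV[R]_d -> R) :
  mixedC1 js F -> mixedC1 js (fun q => F (s q)).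
Proof.
elim: js F => [|j js IH] F /=; first by move=> [M FM]; exists M => p; exact: FM.
move=> [/IH h [F' [dF /IH h']]]; split => //; exists (fun q => F' (s q)).
by split => // p; exact: dF.
Qed.

Lemma mixedC1_cst js P (c : P -> R) M : (forall p, `|c p| <= M) ->
  mixedC1 js (fun p _ => c p).
Proof.
elim: js c M => [|j js IH] c M cM /=; first by exists M.
split; first exact: IH cM; exists (fun _ _ => 0); split.
  by move=> p x cx; exact: segment_derive_cst.
by apply: (IH (fun=> 0) 0) => p; rewrite normr0.
Qed.

Lemma mixedC1_coord js P (i : 'I_d) : mixedC1 js (fun (_ : P) x => x i 0).
Proof.
elim: js => [|j js IH] /=.
  exists (`|lo| + `|hi|) => _ x /(_ i) /andP[h1 h2].
  rewrite ler_norml; apply/andP; split.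
    by have := ler_norm (- lo); have := normr_ge0 hi; rewrite normrN; lra.
  by have := ler_norm hi; have := normr_ge0 lo; lra.
split=> //; exists (fun _ _ => (i == j)%:R); split; last first.
  exact: (@mixedC1_cst _ _ (fun=> (i == j)%:R) `|(i == j)%:R|).
move=> _ x cx; under eq_fun do rewrite updE.
case: eqP => _; last exact: segment_derive_cst.
exact: segment_derive_id.
Qed.

Lemma mixedC1D js P (F F2 : P -> 'cV[R]_d -> R) : mixedC1 js F -> mixedC1 js F2 ->
  mixedC1 js (fun p x => F p x + F2 p x).
Proof.
elim: js F F2 => [|j js IH] F F2 /=.
  move=> [M FM] [M2 FM2]; exists (M + M2) => p x cx.
  by rewrite (le_trans (ler_normD _ _))// lerD ?FM ?FM2.
move=> [hF [F' [dF hF']]] [hF2 [F2' [dF2 hF2']]]; split; first exact: IH.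
exists (fun p x => F' p x + F2' p x); split; last exact: IH.
by move=> p x cx; apply: segment_deriveD; [exact: dF|exact: dF2].
Qed.

Lemma mixedC1M js P (F F2 : P -> 'cV[R]_d -> R) : mixedC1 js F -> mixedC1 js F2 ->
  mixedC1 js (fun p x => F p x * F2 p x).
Proof.
elim: js F F2 => [|j js IH] F F2 /=.
  move=> [M FM] [M2 FM2]; exists (M * M2) => p x cx.
  by rewrite normrM ler_pM ?FM ?FM2.
move=> [hF [F' [dF hF']]] [hF2 [F2' [dF2 hF2']]]; split; first exact: IH.
exists (fun p x => F' p x * F2 p x + F p x * F2' p x); split.
  by move=> p x cx; apply: segment_deriveM; [exact: dF|exact: dF2].
by apply: mixedC1D; exact: IH.
Qed.

Lemma mixedC1_sum js P (I : Type) (s : seq I) (F : I -> P -> 'cV[R]_d -> R) :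
  (forall i, mixedC1 js (F i)) -> mixedC1 js (fun p x => \sum_(i <- s) F i p x).
Proof.
move=> hF; elim: s => [|i s IH].
  under eq_fun do under eq_fun do rewrite big_nil.
  by apply: (@mixedC1_cst _ _ _ 0) => p; rewrite normr0.
under eq_fun do under eq_fun do rewrite big_cons.
exact: mixedC1D.
Qed.

(** The finite index type may vary with [q], so that the grid means of all mesh sizes form a single
    family, with bounds independent of the mesh. *)
Lemma mixedC1_average js P Q (T : Q -> finType) (s : forall q, T q -> P)
    (F : P -> 'cV[R]_d -> R) : mixedC1 js F ->
  mixedC1 js (fun q x => #|T q|%:R^-1 * \sum_(t : T q) F (s q t) x).
Proof.
elim: js F => [|j js IH] F /=.
  move=> [M FM]; exists `|M| => q x cx.
  rewrite normrM normfV normr_nat.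
  (* An empty [T q] is harmless since the inverse of 0 is 0. *)
  have [->|T0] := posnP #|T q|; first by rewrite invr0 mul0r.
  rewrite ler_pdivrMl ?ltr0n// (le_trans (ler_norm_sum _ _ _))//.
  rewrite mulr_natl -sumr_const; apply: ler_sum => t _.
  by rewrite (le_trans (FM _ _ cx)) ?ler_norm.
move=> [/IH h [F' [dF /IH h']]]; split => //.
eexists; split; last exact: h'.
move=> q x cx /=.
have dsum (r : seq (T q)) : segment_derive lo hi
    (fun v => \sum_(t <- r) F (s q t) (upd x j v))
    (fun v => \sum_(t <- r) F' (s q t) (upd x j v)).
  elim: r => [|t r IHr].
    under [X in segment_derive _ _ X]eq_fun do rewrite big_nil.
    under [X in segment_derive _ _ _ X]eq_fun do rewrite big_nil.
    exact: segment_derive_cst.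
  under [X in segment_derive _ _ X]eq_fun do rewrite big_cons.
  under [X in segment_derive _ _ _ X]eq_fun do rewrite big_cons.
  by apply: segment_deriveD => //; exact: dF.
have := segment_deriveM (segment_derive_cst lo hi (#|T q|%:R^-1)) (dsum (index_enum _)).
by under [X in segment_derive _ _ _ X -> _]eq_fun do rewrite mul0r add0r.
Qed.

(** The chain rule as an induction step on the list of directions: [h] and [h'] composed with [F]
    have to be controlled only in the remaining directions. *)
Lemma mixedC1_comp j js P (h h' : R -> R) (F : P -> 'cV[R]_d -> R) :
  (forall p x, cube x -> is_derive (F p x) 1 h (h' (F p x))) ->
  mixedC1 (j :: js) F -> mixedC1 js (fun p x => h (F p x)) ->
  mixedC1 js (fun p x => h' (F p x)) ->
  mixedC1 (j :: js) (fun p x => h (F p x)).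
Proof.
move=> dh /= [hF [F' [dF hF']]] hh hh'; split => //.
exists (fun p x => h' (F p x) * F' p x); split; last exact: mixedC1M.
move=> p x cx; apply: segment_derive_comp; last exact: dF.
by move=> v vI; apply: dh; exact: cube_upd.
Qed.

Lemma mixedC1_expR js P (F : P -> 'cV[R]_d -> R) : mixedC1 js F ->
  mixedC1 js (fun p x => expR (F p x)).
Proof.
elim: js => [|j js IH].
  move=> [M FM]; exists (expR M) => p x cx.
  by rewrite ger0_norm ?expR_ge0// ler_expR (le_trans (ler_norm _))// FM.
move=> hF; have [/IH h _] := hF; exact: (mixedC1_comp (h' := expR)).
Qed.

Lemma mixedC1_inv js P (F : P -> 'cV[R]_d -> R) (m : R) : 0 < m ->
  (forall p x, cube x -> m <= F p x) -> mixedC1 js F ->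
  mixedC1 js (fun p x => (F p x)^-1).
Proof.
move=> m0 Fm; have F0 p x : cube x -> 0 < F p x.
  by move=> /(Fm p); exact: lt_le_trans.
elim: js => [|j js IH].
  move=> _; exists m^-1 => p x cx.
  have Fp := F0 p x cx.
  by rewrite ger0_norm ?invr_ge0 ?(ltW Fp)// lef_pV2 ?posrE ?Fm.
move=> hF; have [/IH h _] := hF.
(* Written as a product of inverses, the derivative falls under the induction hypothesis. *)
apply: (mixedC1_comp (h' := fun v => -1 * (v^-1 * v^-1))) => //.
  move=> p x cx; have := @is_deriveV _ id (F p x) 1 1.
  move=> /(_ (lt0r_neq0 (F0 p x cx)) (is_derive_id _ _)) hd.
  by apply: (is_derive_eq hd); rewrite /GRing.scale /= mulr1 -exprVn expr2 mulN1r.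
apply: mixedC1M; last exact: mixedC1M.
exact: (@mixedC1_cst _ _ (fun=> -1) `|-1|).
Qed.

Lemma mixedC1_ln js P (F : P -> 'cV[R]_d -> R) (m : R) : 0 < m ->
  (forall p x, cube x -> m <= F p x) -> mixedC1 js F ->
  mixedC1 js (fun p x => ln (F p x)).
Proof.
move=> m0 Fm; have F0 p x : cube x -> 0 < F p x.
  by move=> /(Fm p); exact: lt_le_trans.
elim: js => [|j js IH].
  move=> [M FM]; exists (`|ln m| + `|ln M|) => p x cx.
  have FpM : F p x <= M by rewrite (le_trans (ler_norm _))// FM.
  have M0 : 0 < M by exact: lt_le_trans (F0 p x cx) FpM.
  rewrite ler_norml; apply/andP; split.
    have : ln m <= ln (F p x) by rewrite ler_ln ?posrE ?F0 ?Fm.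
    by have := ler_norm (- ln m); have := normr_ge0 (ln M); rewrite normrN; lra.
  have : ln (F p x) <= ln M by rewrite ler_ln ?posrE ?F0.
  by have := ler_norm (ln M); have := normr_ge0 (ln m); lra.
move=> hF; have hF1 : mixedC1 js F by case: hF.
apply: (mixedC1_comp (h' := fun v => v^-1)) => //; first last.
- exact: (mixedC1_inv m0 Fm).
- exact: IH.
- by move=> p x cx; exact: is_derive1_ln (F0 p x cx).
Qed.

Lemma mixedC1_partial_bounded js P (F : P -> 'cV[R]_d -> R) : mixedC1 js F ->
  forall j, j \in js -> exists2 M, 0 < M & forall p x v w, cube x ->
    lo <= v <= hi -> lo <= w <= hi ->
    `|F p (upd x j w) - F p (upd x j v)| <= M * `|w - v|.
Proof.
elim: js => // i js IH [/IH {}IH [F' [dF hF']]] j; rewrite inE.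
case/predU1P => [->|/IH//].
have [M M0 FM] := mixedC1_bounded hF'; exists M => // p x v w cx vI wI.
apply: (segment_derive_le (dF p x cx)) => // u uI.
by apply: FM; exact: cube_upd.
Qed.

End mixedC1.

(** * Mixed differences of functions on a cube *)

Section mixed_bounded.
Context {R : realType} {d : nat} (lo hi : R).
Hypothesis lohi : lo < hi.
Implicit Types (js : seq 'I_d) (x : 'cV[R]_d) (n : nat) (t : 'I_d -> nat)
  (F : 'cV[R]_d -> R).
Local Notation cube := (@cube R d lo hi).

Definition node n (y : nat) : R := lo + (hi - lo) * (y%:R / n%:R).

Definition grid_point n (m : 'I_d -> nat) : 'cV[R]_d := \col_j node n (m j).

Lemma node_itv n y : (0 < n)%N -> (y <= n)%N -> lo <= node n y <= hi.
Proof.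
move=> n0 yn; rewrite /node.
have h0 : 0 <= y%:R / n%:R :> R by rewrite divr_ge0.
have h1 : y%:R / n%:R <= 1 :> R by rewrite ler_pdivrMr ?ltr0n// mul1r ler_nat.
set u := _ / _ in h0 h1 *.
have lh : 0 <= hi - lo by rewrite subr_ge0 ltW.
have h2 := mulr_ge0 lh h0; have h3 := ler_wpM2l lh h1.
by apply/andP; split; lra.
Qed.

Lemma grid_point_cube n m : (forall j, m j < n)%N -> cube (grid_point n m).
Proof.
move=> mn j; rewrite mxE; apply: node_itv; last exact: ltnW.
exact: leq_ltn_trans (mn j).
Qed.

(** The dual functionals applied in the directions [js] only, so that estimates can proceed one
    direction at a time. *)
Fixpoint partial_coef n t js F x : R :=
  match js with
  | [::] => F x
  | j :: js' => \sum_(0 <= y < n)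
      step_coef n (t j) y * partial_coef n t js' F (upd x j (node n y))
  end.

Lemma upd_comm x i j v w : i != j -> upd (upd x j v) i w = upd (upd x i w) j v.
Proof.
move=> ij; apply/matrixP => k l; rewrite !mxE.
by have [->|//] := eqVneq k i; rewrite (negbTE ij).
Qed.

Lemma segment_derive_sum (I : eqType) (s : seq I) (c : I -> R)
    (phi phi' : I -> R -> R) :
  (forall i, i \in s -> segment_derive lo hi (phi i) (phi' i)) ->
  segment_derive lo hi (fun v => \sum_(i <- s) c i * phi i v)
    (fun v => \sum_(i <- s) c i * phi' i v).
Proof.
elim: s => [|i s IH] h.
  under [X in segment_derive _ _ X]eq_fun do rewrite big_nil.
  under [X in segment_derive _ _ _ X]eq_fun do rewrite big_nil.
  exact: segment_derive_cst.
under [X in segment_derive _ _ X]eq_fun do rewrite big_cons.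
under [X in segment_derive _ _ _ X]eq_fun do rewrite big_cons.
apply: segment_deriveD; last first.
  by apply: IH => k ks; apply: h; rewrite inE ks orbT.
have := segment_deriveM (segment_derive_cst lo hi (c i)) (h i (mem_head _ _)).
by under [X in segment_derive _ _ _ X -> _]eq_fun do rewrite mul0r add0r.
Qed.

(** The functionals are finite linear combinations of evaluations in other directions, hence they
    commute with the derivative in direction [j]. *)
Lemma partial_coef_derive n t js j F F' : (0 < n)%N -> j \notin js ->
  (forall x, cube x -> segment_derive lo hi
     (fun v => F (upd x j v)) (fun v => F' (upd x j v))) ->
  forall x, cube x -> segment_derive lo hi
     (fun v => partial_coef n t js F (upd x j v))
     (fun v => partial_coef n t js F' (upd x j v)).
Proof.
move=> n0 + dF; elim: js => [|i js IH] //=.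
rewrite inE negb_or eq_sym => /andP[ij jjs] x cx.
under [X in segment_derive _ _ X]eq_fun do
  under eq_bigr do rewrite (upd_comm _ _ _ ij).
under [X in segment_derive _ _ _ X]eq_fun do
  under eq_bigr do rewrite (upd_comm _ _ _ ij).
apply: segment_derive_sum => y; rewrite mem_index_iota => /andP[_ yn].
by apply: IH => //; apply: cube_upd => //; apply: node_itv => //; exact: ltnW.
Qed.

Lemma sum_step_coef n (t : nat) (a : nat -> R) : (0 < t < n)%N ->
  \sum_(0 <= y < n) step_coef n t y * a y = a t - a t.-1.
Proof.
case: t => // t /andP[_ tn].
transitivity (\sum_(0 <= y < n) (a y * (t.+1 == y)%:R - a y * (t == y)%:R)).
  apply: eq_bigr => y _; rewrite /step_coef /= eqSS mulrC mulrBr.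
  by rewrite (eq_sym y) (eq_sym y).
by rewrite sumrB !sum_nat_delta /= tn (ltnW tn).
Qed.

(** In each direction the functional is a mean, which does not enlarge the bound, or a backward
    difference, which the mean value theorem turns into a derivative times [(hi - lo) / n]; the
    factor [1/n] is the weight. *)
Lemma partial_coef_le js P (F : P -> 'cV[R]_d -> R) : uniq js ->
  mixedC1 lo hi js F ->
  exists2 M, 0 < M & forall p n t x, (0 < n)%N -> (forall j, t j < n)%N ->
    cube x -> `|partial_coef n t js (F p) x| <= M * \prod_(j <- js) step_weight n (t j).
Proof.
elim: js F => [|j js IH] F.
  move=> _ /mixedC1_bounded[M M0 FM]; exists M => // p n t x _ _ cx.
  by rewrite big_nil mulr1 /= FM.
move=> /= /andP[jjs ujs] [hF [F' [dF hF']]].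
have [M1 M10 hM1] := IH _ ujs hF; have [M2 M20 hM2] := IH _ ujs hF'.
exists (M1 + (hi - lo) * M2) => [|p n t x n0 tn cx].
  by rewrite addr_gt0// mulr_gt0// subr_gt0.
rewrite big_cons; set W := \prod_(i <- js) _.
have W0 : 0 <= W by apply: prodr_ge0 => i _; exact: step_weight_ge0.
have ny y : (y < n)%N -> cube (upd x j (node n y)).
  by move=> yn; apply: cube_upd => //; apply: node_itv => //; exact: ltnW.
have nR : 0 < n%:R :> R by rewrite ltr0n.
have [t0|t0] := posnP (t j).
  rewrite /step_weight t0 /= mul1r (@le_trans _ _ (M1 * W))//; last first.
    by rewrite ler_wpM2r// lerDl mulr_ge0 ?ltW// subr_gt0.
  rewrite (le_trans (ler_norm_sum _ _ _))//.
  apply: (@le_trans _ _ (\sum_(0 <= y < n) n%:R^-1 * (M1 * W))).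
    apply: ler_sum_nat => y /andP[_ yn]; rewrite normrM /step_coef /=.
    by rewrite ger0_norm// ler_wpM2l// hM1//; exact: ny.
  by rewrite sum_cst_nat mulrA divff ?mul1r// gt_eqF.
rewrite sum_step_coef ?t0 ?tn//.
have dT := partial_coef_derive t n0 jjs (dF p) cx.
have t1n : ((t j).-1 <= n)%N by rewrite (leq_trans (leq_pred _))// ltnW.
apply: le_trans (segment_derive_le dT (M := M2 * W) _ _ _) _.
- by move=> v vI; apply: hM2 => //; exact: cube_upd.
- exact: node_itv.
- by apply: node_itv => //; exact: ltnW.
have -> : node n (t j) - node n (t j).-1 = (hi - lo) / n%:R.
  by rewrite /node -{1}(prednK t0) -natr1; field; rewrite gt_eqF.
rewrite ger0_norm; last by rewrite divr_ge0// ltW// subr_gt0.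
rewrite /step_weight gtn_eqF//.
have : 0 <= n%:R^-1 * W by rewrite mulr_ge0.
move=> h; rewrite -subr_ge0.
have -> : (M1 + (hi - lo) * M2) * (n%:R^-1 * W) - M2 * W * ((hi - lo) / n%:R) =
   M1 * (n%:R^-1 * W) by ring.
by rewrite mulr_ge0// ltW.
Qed.

Definition grid_mix n js x (y : 'I_d -> nat) : 'cV[R]_d :=
  \col_i if i \in js then node n (y i) else x i 0.

(** [y0] pins the indices outside [js], so that the iterated sums can be compared as sums over one
    finite type. *)
Lemma partial_coefE n t js F x (y0 : {ffun 'I_d -> 'I_n}) : uniq js ->
  partial_coef n t js F x =
  \sum_(y : {ffun 'I_d -> 'I_n} | [forall i, (i \notin js) ==> (y i == y0 i)])
    (\prod_(j <- js) step_coef n (t j) (y j)) * F (grid_mix n js x (fun i => y i)).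
Proof.
elim: js x y0 => [|j js IH] x y0 /=.
  move=> _; rewrite (big_pred1 y0) => [|y]; last first.
    apply/forallP/eqP => [h|-> i]; last exact: eqxx.
    by apply/ffunP => i; apply/eqP; have := h i.
  rewrite big_nil mul1r; congr F; apply/matrixP => i k.
  by rewrite mxE in_nil ord1.
move=> /andP[jjs ujs].
rewrite [RHS](partition_big (fun y : {ffun 'I_d -> 'I_n} => y j) predT)//=.
rewrite big_mkord; apply: eq_bigr => v _.
pose y1 := [ffun i => if i == j then v else y0 i].
rewrite (IH _ y1 ujs) mulr_sumr; apply: eq_big => [y|y].
  apply/forallP/andP => [h|[/forallP h /eqP yj] i].
    split; last by have := h j; rewrite jjs ffunE eqxx.
    apply/forallP => i; apply/implyP; rewrite inE negb_or => /andP[ij ijs].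
    by have := h i; rewrite ijs ffunE (negbTE ij).
  apply/implyP => ijs; rewrite ffunE; have [->|ij] := eqVneq i j.
    by rewrite yj.
  by have := h i; rewrite inE negb_or ij ijs.
move=> /forallP h; have yj : y j = v.
  by have := h j; rewrite jjs ffunE eqxx => /eqP.
rewrite big_cons yj -mulrA; congr (_ * (_ * F _)).
apply/matrixP => i k; rewrite !mxE inE.
have [->|//] := eqVneq i j; by rewrite (negbTE jjs) yj.
Qed.

Lemma tensor_coefE n t F x : (0 < n)%N ->
  tensor_coef n (fun m => F (grid_point n m)) t =
  partial_coef n t (enum 'I_d) F x.
Proof.
move=> n0; rewrite (@partial_coefE _ _ _ _ _ (zero_index d n0)) ?enum_uniq//.
apply: eq_big => [y|y _].
  by apply/esym/forallP => i; rewrite mem_enum.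
rewrite big_enum /=; congr (_ * F _); apply/matrixP => i k.
by rewrite !mxE mem_enum.
Qed.

(** What the quadrature estimates ask of the integrand. These bounds are preserved by pointwise
    limits with the same [M]. *)
Definition mixed_bounded M F : Prop :=
  (forall n t x, (0 < n)%N -> (forall j, t j < n)%N -> cube x ->
    `|partial_coef n t (enum 'I_d) F x| <= M * tensor_weight n t) /\
  (forall x x', cube x -> cube x' ->
    `|F x' - F x| <= M * \sum_j `|x' j 0 - x j 0|).

Lemma mixedC1_lipschitz P (F : P -> 'cV[R]_d -> R) :
  mixedC1 lo hi (enum 'I_d) F -> exists2 M, 0 < M & forall p x x',
    cube x -> cube x' -> `|F p x' - F p x| <= M * \sum_j `|x' j 0 - x j 0|.
Proof.
move=> hF.
(* One coordinate is changed at a time: the intermediate points agree with [x'] on a list of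
   directions and with [x] elsewhere. *)
suff [M M0 h] : exists2 M, 0 < M & forall p x x', cube x -> cube x' ->
    `|F p (\col_i if i \in enum 'I_d then x' i 0 else x i 0) - F p x| <=
    M * \sum_(j <- enum 'I_d) `|x' j 0 - x j 0|.
  exists M => // p x x' cx cx'; have := h p x x' cx cx'.
  rewrite big_enum /=; rewrite (_ : \col_i _ = x')//.
  by apply/matrixP => i k; rewrite mxE mem_enum ord1.
elim: (enum 'I_d) (enum_uniq 'I_d) => [_|j js IH /= /andP[jjs /IH[M M0 h]]].
  exists 1 => // p x x' _ _; rewrite big_nil mulr0 (_ : \col_i _ = x) ?subrr ?normr0//.
  by apply/matrixP => i k; rewrite mxE ord1.
have [M2 M20 h2] := mixedC1_partial_bounded hF (mem_enum _ j).
exists (M + M2) => [|p x x' cx cx']; first exact: addr_gt0.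
set u := \col_i (if i \in js then x' i 0 else x i 0).
have cu : cube u by move=> i; rewrite mxE; case: ifP => _; [exact: cx'|exact: cx].
have -> : \col_i (if i \in j :: js then x' i 0 else x i 0) = upd u j (x' j 0).
  by apply/matrixP => i k; rewrite !mxE inE; case: eqP => [->|].
have := h p x x' cx cx'; rewrite -/u => hu.
have := h2 p u (x j 0) (x' j 0) cu (cx j) (cx' j).
have -> : upd u j (x j 0) = u.
  apply/matrixP => i k; rewrite !mxE.
  by case: eqP => [->|//]; rewrite (negbTE jjs).
move=> h3; rewrite big_cons -(subrKA (F p u)) (le_trans (ler_normD _ _))//.
rewrite (le_trans (lerD h3 hu))// -subr_ge0.
set S := \sum_(i <- js) _.
have S0 : 0 <= S by exact: sumr_ge0.
have -> : (M + M2) * (`|x' j 0 - x j 0| + S) - (M2 * `|x' j 0 - x j 0| + M * S)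
  = M * `|x' j 0 - x j 0| + M2 * S by ring.
by rewrite addr_ge0// mulr_ge0// ltW.
Qed.

Lemma mixedC1_mixed_bounded P (F : P -> 'cV[R]_d -> R) :
  mixedC1 lo hi (enum 'I_d) F ->
  exists2 M, 0 < M & forall p, mixed_bounded M (F p).
Proof.
move=> hF; have [M1 M10 h1] := partial_coef_le (enum_uniq _) hF.
have [M2 M20 h2] := mixedC1_lipschitz hF.
exists (M1 + M2) => [|p]; first exact: addr_gt0.
split=> [n t x n0 tn cx|x x' cx cx'].
  apply: le_trans (h1 p n t x n0 tn cx) _; rewrite big_enum /=.
  by rewrite ler_wpM2r ?tensor_weight_ge0// lerDl ltW.
apply: le_trans (h2 p x x' cx cx') _.
by rewrite ler_wpM2r ?sumr_ge0// lerDr ltW.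
Qed.

Lemma cvg_partial_coef n t js (F : nat -> 'cV[R]_d -> R) (f : 'cV[R]_d -> R) :
  (0 < n)%N -> (forall x, cube x -> F N x @[N --> \oo] --> f x) ->
  forall x, cube x ->
    partial_coef n t js (F N) x @[N --> \oo] --> partial_coef n t js f x.
Proof.
move=> n0 Ff; elim: js => [|j js IH] x cx /=; first exact: Ff.
rewrite [X in _ --> X]big_mkord.
under eq_fun do rewrite big_mkord.
apply: (cvg_big _ (op := +%R)) => [|y _]; first exact: add_continuous.
apply: cvgMl_tmp; apply: IH; apply: cube_upd => //.
by apply: node_itv => //; exact: ltnW.
Qed.

Lemma mixed_bounded_cvg M (F : nat -> 'cV[R]_d -> R) (f : 'cV[R]_d -> R) :
  (forall N, mixed_bounded M (F N)) ->
  (forall x, cube x -> F N x @[N --> \oo] --> f x) -> mixed_bounded M f.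
Proof.
move=> hF Ff; split=> [n t x n0 tn cx|x x' cx cx'].
  have h : `|partial_coef n t (enum 'I_d) (F N) x| @[N --> \oo]
     --> `|partial_coef n t (enum 'I_d) f x|.
    by apply: cvg_norm; exact: cvg_partial_coef.
  apply: cvgr_to_le h _.
  by apply: nearW => N; have [+ _] := hF N; apply.
have h : `|F N x' - F N x| @[N --> \oo] --> `|f x' - f x|.
  by apply: cvg_norm; apply: cvgB; exact: Ff.
apply: cvgr_to_le h _.
by apply: nearW => N; have [_ +] := hF N; apply.
Qed.

End mixed_bounded.

(** * Lattice points and cells *)

Section lattice_error.
Context {R : realType}.

(** The cell of the shift on the periodic grid of mesh [1/n]. *)
Definition shift_index (n : nat) (v : R) : nat :=
  `|(Num.floor (n%:R * v) %% n)%Z|%N.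

Lemma shift_index_lt n v : (0 < n)%N -> (shift_index n v < n)%N.
Proof.
move=> n0; rewrite -ltz_nat /shift_index gez0_abs ?modz_ge0//; last first.
  by rewrite eqz_nat -lt0n.
by rewrite ltz_pmod.
Qed.

(** Put [N = a + floor (n v)]. Dividing [N] by [n] gives the integer part of [a/n + v] as quotient
    and the cell as remainder; the fractional part of [n v] is the position inside the cell. *)
Lemma frac_cell n (a c : nat) (v : R) : (0 < n)%N ->
  c = ((a + shift_index n v) %% n)%N ->
  c%:R / n%:R <= Defs.frac (a%:R / n%:R + v) <= c%:R / n%:R + n%:R^-1.
Proof.
move=> n0 cdef; have nR : 0 < n%:R :> R by rewrite ltr0n.
have nZ : n%:Z != 0 by rewrite eqz_nat -lt0n.
pose f := Num.floor (n%:R * v); pose N := (a%:Z + f)%R.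
have cE : c%:Z = (N %% n)%Z.
  rewrite cdef -modz_nat PoszD /shift_index gez0_abs ?modz_ge0//.
  by rewrite modzDmr.
have NE : N%:~R = (N %/ n)%Z%:~R * n%:R + c%:R :> R.
  by rewrite [in LHS](divz_eq N n) -cE intrD intrM -!pmulrn.
have /andP[f1 f2] := floor_itv (n%:R * v).
set rho := n%:R * v - f%:~R.
have r0 : 0 <= rho by rewrite subr_ge0.
have r1 : rho < 1 by move: f2; rewrite intrD -/f /rho; lra.
have NE2 : N%:~R = a%:R + f%:~R :> R by rewrite intrD -pmulrn.
have vE : a%:R / n%:R + v = (N %/ n)%Z%:~R + (c%:R + rho) / n%:R.
  apply: (@mulIf _ n%:R); first by rewrite gt_eqF.
  rewrite !mulrDl !divfK ?gt_eqF// -?addrA.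
  by move: NE; rewrite NE2 /rho; lra.
have q0 : 0 <= (c%:R + rho) / n%:R := divr_ge0 (addr_ge0 (ler0n _ _) r0) (ltW nR).
have cn : c%:R + 1 <= n%:R :> R by rewrite natr1 ler_nat cdef ltn_mod.
have fl : Num.floor (a%:R / n%:R + v) = (N %/ n)%Z.
  apply: floor_def; rewrite vE intrD lerDl ltrD2l.
  apply/andP; split => //.
  by rewrite ltr_pdivrMr// mul1r; lra.
rewrite /Defs.frac fl vE addrC addKr mulrDl lerDl lerD2l.
apply/andP; split; first exact: divr_ge0 r0 (ltW nR).
by rewrite ler_pdivrMr// mulVf ?gt_eqF// ltW.
Qed.

Variables (d : nat) (lo hi : R).
Hypothesis lohi : lo < hi.

Definition scaled_lattice_point n z (shift : 'cV[R]_d) i : 'cV[R]_d :=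
  (hi - lo) *: lattice_point n z shift i + const_mx lo.

Lemma scaled_lattice_pointE n z (shift : 'cV[R]_d) i j :
  scaled_lattice_point n z shift i j 0 =
  lo + (hi - lo) * Defs.frac ((i * z j)%:R / n%:R + shift j 0).
Proof. by rewrite !mxE addrC natrM. Qed.

Lemma scaled_lattice_point_near n z (shift : 'cV[R]_d) i j : (0 < n)%N ->
  `|scaled_lattice_point n z shift i j 0 - grid_point lo hi n
      (lattice_index n z (fun j => shift_index n (shift j 0)) i) j 0|
   <= (hi - lo) / n%:R.
Proof.
move=> n0; rewrite scaled_lattice_pointE mxE /node opprD addrACA subrr add0r.
have /andP[h1 h2] := @frac_cell _ (i * z j) _ (shift j 0) n0 erefl.
have lh : 0 <= hi - lo by rewrite subr_ge0 ltW.
rewrite -mulrBr normrM (ger0_norm lh) ler_wpM2l// ger0_norm ?subr_ge0//.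
by rewrite lerBlDl.
Qed.

Lemma scaled_lattice_point_cube n z (shift : 'cV[R]_d) i :
  cube lo hi (scaled_lattice_point n z shift i).
Proof.
move=> j; rewrite scaled_lattice_pointE; set v := _ + shift j 0.
have /andP[f1 f2] := floor_itv v.
have h1 : 0 <= Defs.frac v by rewrite subr_ge0.
have h2 : Defs.frac v <= 1.
  by rewrite /Defs.frac; move: f2; rewrite intrD; lra.
have lh : 0 <= hi - lo by rewrite subr_ge0 ltW.
have h3 := mulr_ge0 lh h1; have h4 := ler_wpM2l lh h2.
by apply/andP; split; lra.
Qed.

Definition grid_mean n (F : 'cV[R]_d -> R) : R :=
  n%:R^-1 ^+ d * \sum_(y : {ffun 'I_d -> 'I_n}) F (grid_point lo hi n (fun j => y j)).

Lemma sqrrD_le (a b : R) : (a + b) ^+ 2 <= 2 * (a ^+ 2 + b ^+ 2).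
Proof. by have := sqr_ge0 (a - b); nra. Qed.

Lemma lattice_error n z (shift : 'cV[R]_d) F M : (0 < n)%N -> 0 <= M ->
  mixed_bounded lo hi M F ->
  (n%:R^-1 * (\sum_(1 <= i < n.+1) F (scaled_lattice_point n z shift i))
    - grid_mean n F) ^+ 2 <=
  2 * M ^+ 2 * (2 ^+ d * lattice_discrepancy n z
      (fun j => shift_index n (shift j 0)) + (d%:R * ((hi - lo) / n%:R)) ^+ 2).
Proof.
move=> n0 M0 [hF1 hF2]; set m := fun j : 'I_d => shift_index n (shift j 0).
have nR : 0 < n%:R :> R by rewrite ltr0n.
(* [A] is the cost of moving the points to the grid, controlled by the Lipschitz bound; [B] is the
   quadrature error on the grid. *)
pose A := n%:R^-1 * (\sum_(1 <= i < n.+1) F (scaled_lattice_point n z shift i))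
  - n%:R^-1 * (\sum_(1 <= i < n.+1) F (grid_point lo hi n (lattice_index n z m i))).
pose B := n%:R^-1 * (\sum_(0 <= i < n) F (grid_point lo hi n (lattice_index n z m i)))
  - grid_mean n F.
have -> : n%:R^-1 * (\sum_(1 <= i < n.+1) F (scaled_lattice_point n z shift i))
    - grid_mean n F = A + B.
  suff SE : \sum_(1 <= i < n.+1) F (grid_point lo hi n (lattice_index n z m i)) =
    \sum_(0 <= i < n) F (grid_point lo hi n (lattice_index n z m i)) by rewrite /A /B SE subrKA.
  rewrite -[RHS](@sum_periodic_shift _ _ n 1) => [|r].
    by rewrite big_add1 /=; apply: eq_bigr => i _; rewrite add1n.
  congr (F (grid_point _ _ _ _)); apply/funext => j.
  by rewrite /lattice_index mulnDl -addnA addnCA mulnC modnMDl.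
have Bh : B ^+ 2 <= M ^+ 2 * 2 ^+ d * lattice_discrepancy n z m.
  rewrite /B /grid_mean.
  apply: (koksma_discrete n0 (Phi := fun y => F (grid_point lo hi n y))) => t tn.
  have x0 : cube lo hi (const_mx lo : 'cV[R]_d).
    by move=> j; rewrite mxE lexx ltW.
  by rewrite (tensor_coefE lo hi t F (const_mx lo) n0) hF1.
have gp i : cube lo hi (grid_point lo hi n (lattice_index n z m i)).
  by apply: grid_point_cube => // j; rewrite ltn_mod.
have Ah : `|A| <= M * (d%:R * ((hi - lo) / n%:R)).
  rewrite /A -mulrBr -sumrB normrM normfV normr_nat ler_pdivrMl//.
  rewrite (le_trans (ler_norm_sum _ _ _))//.
  set Y := M * _.
  have -> : n%:R * Y = \sum_(1 <= i < n.+1) Y.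
    by rewrite sumr_const_nat subn1 mulr_natl.
  apply: ler_sum => i _; rewrite (le_trans (hF2 _ _ (gp i) _))//.
    exact: scaled_lattice_point_cube.
  rewrite ler_wpM2l//; set r := _ / _.
  have -> : d%:R * r = \sum_(j < d) r by rewrite sumr_const card_ord mulr_natl.
  by apply: ler_sum => j _; exact: scaled_lattice_point_near.
apply: le_trans (sqrrD_le _ _) _.
rewrite -mulrA ler_wpM2l// mulrDr addrC lerD//; first by rewrite mulrA.
rewrite -[leLHS]real_normK ?num_real// -exprMn lerXn2r ?nnegrE//.
have lh : 0 <= hi - lo by rewrite subr_ge0 ltW.
by rewrite mulr_ge0// mulr_ge0// divr_ge0.
Qed.

End lattice_error.

(** * Lebesgue measure on boxes and Riemann sums *)

Section tuple_box.
Context {R : realType}.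

Definition tuple_box d (A : 'I_d -> set R) : set (d.-tuple R) :=
  [set t | forall j, A j (tnth t j)].

Lemma measurable_tuple_box d (A : 'I_d -> set R) :
  (forall j, measurable (A j)) -> measurable (tuple_box A).
Proof.
move=> mA.
have -> : tuple_box A = ~` \bigcup_j ((@tnth d R)^~ j @^-1` (~` A j)).
  apply/seteqP; split => t /=; first by move=> h [j _]; apply; exact: h.
  by move=> h j; apply: contrapT => nA; apply: h; exists j.
apply: measurableC; apply: countable_bigcupT_measurable => [|j]; first exact: countableP.
rewrite -[X in measurable X]setTI; apply: measurable_tnth => //.
exact: measurableC.
Qed.

Lemma lebesgue_tuple_box d (A : 'I_d -> set R) (a : 'I_d -> R) :
  (forall j, measurable (A j)) ->
  (forall j, lebesgue_measure (A j) = (a j)%:E) ->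
  lebesgue_tuple R d (tuple_box A) = (\prod_j a j)%:E.
Proof.
elim: d A a => [|d IH] A a mA Aa /=.
  rewrite big_ord0 diracE mem_set//; by case.
rewrite big_ord_recl EFinM /cons_measure /pushforward.
have -> : (@tuple_cons R d) @^-1` tuple_box A =
    A ord0 `*` tuple_box (fun j => A (lift ord0 j)).
  apply/seteqP; split=> -[x t] /=.
    move=> h; split=> [|j] /=; first by have := h ord0; rewrite tnth0.
    by have := h (lift ord0 j); rewrite tnthS.
  move=> [Ax At] j /=; case: (unliftP ord0 j) => [j'|] ->.
    by rewrite tnthS; exact: At.
  by rewrite tnth0.
rewrite product_measure1E; last 2 first.
- exact: mA.
- exact: measurable_tuple_box.
congr (_ * _)%E; first exact: Aa.
exact: (IH _ (fun j => a (lift ord0 j))).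
Qed.

End tuple_box.

Section partition_integral.
Context {d} {T : measurableType d} {R : realType}.
Variable mu : {measure set T -> \bar R}.
Variables (D : set T) (V : R) (I : finType) (B : I -> set T).
Hypothesis mD : measurable D.
Hypothesis muD : mu D = V%:E.
Hypothesis mB : forall i, measurable (B i).

Let bounded_integrable (f : T -> R) (M : R) : measurable_fun D f ->
  (forall x, D x -> `|f x| <= M) -> mu.-integrable D (EFin \o f).
Proof.
move=> mf fM; apply: measurable_bounded_integrable => //.
  by rewrite muD ltry.
exists M; split; first exact: num_real.
by move=> N MN x Dx; exact: le_trans (fM x Dx) (ltW MN).
Qed.

Let measurable_step (s : seq I) (c : I -> R) :
  measurable_fun D (fun x => \sum_(i <- s) c i * \1_(B i) x).
Proof.
apply: measurable_sum => i; apply: measurable_funM; first exact: measurable_cst.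
exact: (measurable_funS measurableT (@subsetT _ D) (measurable_indic (mB i))).
Qed.

Let step_le (s : seq I) (c : I -> R) x :
  `|\sum_(i <- s) c i * \1_(B i) x| <= \sum_(i <- s) `|c i|.
Proof.
rewrite (le_trans (ler_norm_sum _ _ _))//; apply: ler_sum => i _.
by rewrite normrM indicE ler_piMr// normr_nat; case: (_ \in _).
Qed.

Let Rintegral_step (s : seq I) (c : I -> R) :
  \int[mu]_(x in D) (\sum_(i <- s) c i * \1_(B i) x) =
  \sum_(i <- s) c i * fine (mu (B i `&` D)).
Proof.
have ind i : mu.-integrable D (EFin \o \1_(B i)).
  apply: (@bounded_integrable _ 1).
    exact: (measurable_funS measurableT (@subsetT _ D) (measurable_indic (mB i))).
  by move=> x _; rewrite indicE normr_nat; case: (_ \in _).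
elim: s => [|i s IH].
  under eq_Rintegral do rewrite big_nil.
  by rewrite big_nil Rintegral_cst// mul0r.
under eq_Rintegral do rewrite big_cons.
rewrite RintegralD//; last 2 first.
  rewrite (_ : EFin \o _ = (fun x => ((c i)%:E * (EFin \o \1_(B i)) x)%E))//.
  exact: integrableZl.
  apply: bounded_integrable; first exact: measurable_step.
  by move=> x _; exact: step_le.
rewrite big_cons IH RintegralZl//; congr (_ * _ + _).
by rewrite /Rintegral integral_indic.
Qed.

(** Stating the partition as indicators that sum to 1 writes [f] minus its step approximation as a
    combination of the differences [f - c i], at most [e] in absolute value. *)
Lemma Rintegral_partition (f : T -> R) (c : I -> R) (e : R) :
  measurable_fun D f ->
  (forall x, D x -> \sum_i \1_(B i) x = 1 :> R) ->
  (forall x i, D x -> B i x -> `|f x - c i| <= e) ->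
  `|\int[mu]_(x in D) f x - \sum_i c i * fine (mu (B i `&` D))| <= e * V.
Proof.
move=> mf B1 fc; pose S x := \sum_i c i * \1_(B i) x.
have fS x : D x -> `|f x - S x| <= e.
  move=> Dx; have -> : f x - S x = \sum_i (f x - c i) * \1_(B i) x.
    under [RHS]eq_bigr do rewrite mulrBl.
    by rewrite sumrB -mulr_sumr B1// mulr1.
  rewrite (le_trans (ler_norm_sum _ _ _))//.
  rewrite -[leRHS]mulr1 -(B1 x Dx) mulr_sumr; apply: ler_sum => i _.
  rewrite normrM indicE; case: (boolP (x \in B i)) => [xB|_].
    by rewrite normr1 !mulr1; apply: fc => //; rewrite inE in xB.
  by rewrite normr0 !mulr0.
have mS : measurable_fun D S by exact: measurable_step.
have iS : mu.-integrable D (EFin \o S).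
  by apply: bounded_integrable mS _ => x _; exact: step_le.
have fM x : D x -> `|f x| <= e + \sum_i `|c i|.
  move=> Dx; rewrite -[f x](subrK (S x)) (le_trans (ler_normD _ _))// lerD//.
    exact: fS.
  exact: step_le.
have if_ : mu.-integrable D (EFin \o f) by exact: bounded_integrable mf fM.
rewrite -Rintegral_step -RintegralB//.
rewrite (le_trans (le_normr_Rintegral _ _))//.
  by have := integrableB mD if_ iS; apply: eq_integrable.
have -> : e * V = \int[mu]_(x in D) cst e x by rewrite Rintegral_cst// muD.
apply: le_Rintegral => //.
- have mfS : measurable_fun D (fun x => `|f x - S x|).
    by apply: measurableT_comp => //; exact: measurable_funB.
  by apply: (bounded_integrable mfS (M := e)) => x Dx; rewrite normr_id fS.
- by apply: (bounded_integrable (measurable_cst _) (M := `|e|)).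
Qed.

End partition_integral.

Section riemann_sum.
Context {R : realType} (d : nat) (lo hi : R).
Hypothesis lohi : lo < hi.

(** Half-open, except that the last cell is closed at [hi]; this way the cells partition the closed
    segment. *)
Definition cell n (m : nat) : set R :=
  [set` Interval (BLeft (node lo hi n m)) (BSide (m.+1 < n)%N (node lo hi n m.+1))].

Lemma nodeS n m : (0 < n)%N ->
  node lo hi n m.+1 = node lo hi n m + (hi - lo) / n%:R.
Proof.
by move=> n0; rewrite /node -natr1; field; rewrite pnatr_eq0 -lt0n.
Qed.

Lemma node0 n : node lo hi n 0 = lo.
Proof. by rewrite /node mul0r mulr0 addr0. Qed.

Lemma noden n : (0 < n)%N -> node lo hi n n = hi.
Proof.
move=> n0; rewrite /node divff ?pnatr_eq0 -?lt0n// mulr1.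
by rewrite addrC subrK.
Qed.

Lemma node_lt n m : (0 < n)%N -> node lo hi n m < node lo hi n m.+1.
Proof.
by move=> n0; rewrite nodeS// ltrDl divr_gt0 ?ltr0n// subr_gt0.
Qed.

Lemma lebesgue_cell n m : (0 < n)%N ->
  lebesgue_measure (cell n m) = ((hi - lo) / n%:R)%:E.
Proof.
move=> n0; rewrite /cell lebesgue_measure_itv /= lte_fin node_lt//.
by rewrite nodeS// -EFinB addrAC subrr add0r.
Qed.

Lemma cellP n m x : cell n m x ->
  node lo hi n m <= x <= node lo hi n m.+1.
Proof.
rewrite /cell /= in_itv /= => /andP[->] /=.
by case: (m.+1 < n)%N => //= /ltW.
Qed.

Lemma cell_sub n m x : (m < n)%N -> cell n m x -> lo <= x <= hi.
Proof.
move=> mn /cellP /andP[h1 h2]; have n0 : (0 < n)%N by exact: leq_ltn_trans mn.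
have /andP[h3 _] := node_itv lohi n0 (ltnW mn).
have /andP[_ h4] := node_itv lohi n0 mn.
by rewrite (le_trans h3)//= (le_trans h2).
Qed.

Lemma sum_cell n x : (0 < n)%N -> lo <= x <= hi ->
  \sum_(m < n) \1_(cell n m) x = 1 :> R.
Proof.
move=> n0 /andP[lx xh].
(* The cut-off at [m = n] makes every cell indicator a decrement of [g], including that of the
   closed last cell. *)
pose g m : R := if (m < n)%N then (node lo hi n m <= x)%R%:R else 0.
rewrite -(big_mkord predT (fun m => \1_(cell n m) x)).
transitivity (\sum_(0 <= m < n) - (g m.+1 - g m)).
  apply: eq_big_nat => m /andP[_ mn]; rewrite indicE opprB /g mn.
  rewrite mem_setE /cell in_itv /=; case: ifPn => /= [mn'|].
    have [h|h] := leP (node lo hi n m.+1) x.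
      by rewrite (le_trans (ltW (node_lt m n0)) h) subrr.
    by rewrite andbT subr0.
  rewrite -leqNgt => nm; have -> : m.+1 = n by apply/eqP; rewrite eqn_leq mn.
  by rewrite noden// xh andbT subr0.
rewrite sumrN telescope_sumr// /g n0 ltnn node0 lx opprB subr0.
by [].
Qed.

Definition box_cell n (y : {ffun 'I_d -> 'I_n}) : set (d.-tuple R) :=
  tuple_box (fun j => cell n (y j)).

Let D := @col_of_tuple R d @^-1` cube lo hi.

Lemma cube_tuple_box : D = tuple_box (fun=> `[lo, hi]%classic).
Proof.
by apply/seteqP; split=> t h j; have := h j; rewrite /= in_itv /= mxE.
Qed.

Lemma measurable_cube_tuple : measurable D.
Proof. by rewrite cube_tuple_box; apply: measurable_tuple_box. Qed.

Lemma lebesgue_cube_tuple : lebesgue_tuple R d D = ((hi - lo) ^+ d)%:E.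
Proof.
rewrite cube_tuple_box (lebesgue_tuple_box (a := fun=> hi - lo))//.
  by rewrite prodr_const card_ord.
by move=> j; rewrite lebesgue_measure_itv /= lte_fin lohi.
Qed.

Lemma measurable_box_cell n y : measurable (@box_cell n y).
Proof. by apply: measurable_tuple_box => j; exact: measurable_itv. Qed.

Lemma sum_box_cell n t : (0 < n)%N -> D t ->
  \sum_(y : {ffun 'I_d -> 'I_n}) \1_(box_cell y) t = 1 :> R.
Proof.
move=> n0 Dt.
transitivity (\sum_(y : {ffun 'I_d -> 'I_n}) \prod_j \1_(cell n (y j)) (tnth t j) : R).
  apply: eq_bigr => y _; rewrite indicE.
  case: (boolP (t \in _)) => [|tN].
    rewrite inE => ty; rewrite big1// => j _.
    by rewrite indicE mem_set//; exact: ty.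
  have [j Nj] : exists j, ~ cell n (y j) (tnth t j).
    apply/existsNP => h; move/negP: tN; apply; rewrite inE; exact: h.
  by rewrite (bigD1 j)//= indicE memNset// mul0r.
rewrite -(bigA_distr_bigA (fun j (m : 'I_n) => \1_(cell n m) (tnth t j))).
rewrite big1// => j _; apply: sum_cell => //.
by have := Dt j; rewrite mxE.
Qed.

Lemma lebesgue_box_cell n (y : {ffun 'I_d -> 'I_n}) : (0 < n)%N ->
  fine (lebesgue_tuple R d (box_cell y `&` D)) = ((hi - lo) / n%:R) ^+ d.
Proof.
move=> n0; rewrite setIidl; last first.
  by move=> t ty j; rewrite mxE; exact: cell_sub (ltn_ord (y j)) (ty j).
rewrite (lebesgue_tuple_box (a := fun=> (hi - lo) / n%:R)) /=.
- by rewrite prodr_const card_ord.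
- by move=> j; exact: measurable_itv.
- by move=> j; exact: lebesgue_cell.
Qed.

Variables (F : 'cV[R]_d -> R) (M : R).
Hypothesis M0 : 0 <= M.
Hypothesis F_lip : forall x x', cube lo hi x -> cube lo hi x' ->
  `|F x' - F x| <= M * \sum_j `|x' j 0 - x j 0|.

Lemma box_cell_near n (y : {ffun 'I_d -> 'I_n}) t : (0 < n)%N -> D t ->
  box_cell y t -> `|F (col_of_tuple t) - F (grid_point lo hi n (fun j => y j))|
    <= M * (d%:R * ((hi - lo) / n%:R)).
Proof.
move=> n0 Dt ty; rewrite (le_trans (F_lip _ Dt))//.
  exact: grid_point_cube.
rewrite ler_wpM2l//; set r := _ / _.
have -> : d%:R * r = \sum_(j < d) r by rewrite sumr_const card_ord mulr_natl.
apply: ler_sum => j _; rewrite !mxE.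
have /andP[h1 h2] := cellP (ty j).
rewrite ger0_norm ?subr_ge0// lerBlDl.
by rewrite nodeS in h2.
Qed.

Let step n t := \sum_(y : {ffun 'I_d -> 'I_n})
  F (grid_point lo hi n (fun j => y j)) * \1_(box_cell y) t.

(** By the Lipschitz bound the step functions on finer and finer grids converge at every point of
    the cube. *)
Lemma measurable_lipschitz_cube : measurable_fun D (F \o @col_of_tuple R d).
Proof.
apply: (@measurable_fun_cvg _ _ _ _ (fun N => step N.+1)).
  move=> N; apply: measurable_sum => y; apply: measurable_funM.
    exact: measurable_cst.
  exact: (measurable_funS measurableT (@subsetT _ D)
    (measurable_indic (measurable_box_cell y))).
move=> t Dt; set e := M * (d%:R * (hi - lo)).
have e0 : 0 <= e by rewrite mulr_ge0// mulr_ge0// subr_ge0 ltW.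
have near N : `|(F \o @col_of_tuple R d) t - step N.+1 t| <= e * N.+1%:R^-1.
  have -> : (F \o @col_of_tuple R d) t - step N.+1 t =
    \sum_(y : {ffun 'I_d -> 'I_N.+1}) (F (col_of_tuple t) -
      F (grid_point lo hi N.+1 (fun j => y j))) * \1_(box_cell y) t.
    under [RHS]eq_bigr do rewrite mulrBl.
    by rewrite sumrB -mulr_sumr sum_box_cell// mulr1.
  rewrite (le_trans (ler_norm_sum _ _ _))//.
  rewrite -[leRHS]mulr1 -[X in _ <= _ * X](sum_box_cell (ltn0Sn N) Dt) mulr_sumr.
  apply: ler_sum => y _; rewrite normrM indicE.
  case: (boolP (t \in box_cell y)) => [ty|_]; last by rewrite normr0 !mulr0.
  rewrite normr1 !mulr1 /e -!mulrA; apply: box_cell_near => //.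
  by rewrite inE in ty.
apply/cvgrPdist_le => eps eps0.
have : e * N.+1%:R^-1 @[N --> \oo] --> e * 0.
  by apply: cvgMl_tmp; exact: cvg_harmonic.
rewrite mulr0 => /cvgrPdist_le /(_ _ eps0); apply: filterS => N.
rewrite sub0r normrN ger0_norm; last by rewrite mulr_ge0.
exact: le_trans (near N).
Qed.

Lemma riemann_sum n : (0 < n)%N ->
  `|cube_integral lo hi F - (hi - lo) ^+ d * grid_mean lo hi n F|
  <= M * (d%:R * ((hi - lo) / n%:R)) * (hi - lo) ^+ d.
Proof.
move=> n0.
have := @Rintegral_partition _ _ R (lebesgue_tuple R d) D _ _
  (@box_cell n) measurable_cube_tuple lebesgue_cube_tuple
  (@measurable_box_cell n) (F \o @col_of_tuple R d)
  (fun y => F (grid_point lo hi n (fun j => y j)))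
  (M * (d%:R * ((hi - lo) / n%:R))) measurable_lipschitz_cube.
have -> : \sum_(y : {ffun 'I_d -> 'I_n}) F (grid_point lo hi n (fun j => y j))
    * fine (lebesgue_tuple R d (box_cell y `&` D)) =
    (hi - lo) ^+ d * grid_mean lo hi n F.
  rewrite /grid_mean mulrA mulr_sumr; apply: eq_bigr => y _.
  by rewrite lebesgue_box_cell// mulrC -exprMn.
apply.
- by move=> t Dt; exact: sum_box_cell.
- by move=> t y; exact: box_cell_near.
Qed.

End riemann_sum.

(** * Law of the cell of a random shift *)

Section shift_expectation.
Context {dT : measure_display} {T : measurableType dT} {R : realType}.
Variable P : probability T R.
Variables (d n : nat) (X : {RV P >-> d.-tuple R}).
Hypothesis n0 : (0 < n)%N.
Hypothesis uX : uniform_shift X.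

Definition shift_cell (m : nat) : set R := [set v | shift_index n v = m].

Lemma measurable_shift_cell m : measurable (shift_cell m).
Proof.
have nR : 0 < n%:R :> R by rewrite ltr0n.
pose A (q : int) : set R := if `|(q %% n)%Z|%N == m then
  `[q%:~R / n%:R, (q + 1)%:~R / n%:R[%classic else set0.
have -> : shift_cell m = \bigcup_q A q.
  apply/seteqP; split=> v /=.
    move=> vm; exists (Num.floor (n%:R * v)) => //.
    rewrite /A -[X in X == m]/(shift_index n v) vm eqxx /= in_itv /=.
    have /andP[h1 h2] := floor_itv (n%:R * v).
    by rewrite ler_pdivrMr// ltr_pdivlMr// (mulrC v) h1.
  move=> [q _]; rewrite /A; case: eqP => // qm /=; rewrite in_itv /=.
  rewrite ler_pdivrMr// ltr_pdivlMr// (mulrC v) => /andP[h1 h2].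
  have fq : Num.floor (n%:R * v) = q by apply: floor_def; rewrite h1.
  by rewrite /shift_cell /= /shift_index fq.
apply: countable_bigcupT_measurable => [|q]; first exact: countableP.
by rewrite /A; case: ifP => _; [exact: measurable_itv|exact: measurable0].
Qed.

Definition shift_event (m : 'I_d -> nat) : set T :=
  X @^-1` tuple_box (fun j => shift_cell (m j)).

Lemma measurable_shift_event m : measurable (shift_event m).
Proof.
rewrite -[X in measurable X]setTI; apply: measurable_funPT => //.
by apply: measurable_tuple_box => j; exact: measurable_shift_cell.
Qed.

Lemma prob_shift_event (m : 'I_d -> nat) : (P (shift_event m) <= (n%:R^-1 ^+ d)%:E)%E.
Proof.
have nR : 0 < n%:R :> R by rewrite ltr0n.
have mA : measurable (tuple_box (fun j => shift_cell (m j))).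
  by apply: measurable_tuple_box => j; exact: measurable_shift_cell.
have -> : P (shift_event m) = distribution P X (tuple_box (fun j => shift_cell (m j))).
  by [].
rewrite uX//.
(* The shift value 1 wraps around to cell 0; adding the null set [{1}] accounts for it. *)
pose B j : set R := `[(m j)%:R / n%:R, (m j).+1%:R / n%:R] `|` [set 1].
have mB j : measurable (B j) by apply: measurableU.
have -> : (n%:R^-1 ^+ d)%:E = lebesgue_tuple R d (tuple_box B).
  rewrite (lebesgue_tuple_box (a := fun=> n%:R^-1))//.
    by rewrite prodr_const card_ord.
  move=> j; rewrite /B measureU0//; last exact: lebesgue_measure_set1.
  suff : lebesgue_measure (`[(m j)%:R / n%:R, (m j).+1%:R / n%:R]%classic : set R)
    = n%:R^-1%:E by [].
  rewrite lebesgue_measure_itv /= lte_fin ltr_pM2r ?invr_gt0// ltr_nat ltnSn.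
  by rewrite -EFinB -mulrBl -natr1 addrAC subrr add0r mul1r.
apply: le_measure; rewrite ?inE.
- apply: measurableI => //; exact: measurable_cube_tuple.
- exact: measurable_tuple_box.
move=> t [/= tm tc] j; have := tc j; rewrite mxE; set v := tnth t j => /andP[v0 v1].
have := tm j; rewrite /shift_cell /= -/v.
move: v1; rewrite le_eqVlt => /predU1P[->|v1] vm; first by right.
left; rewrite /= in_itv /=.
have /andP[h1 h2] := floor_itv (n%:R * v).
have f0 : 0 <= Num.floor (n%:R * v) by rewrite floor_ge0 mulr_ge0.
have fn : Num.floor (n%:R * v) < n%:Z.
  by rewrite -(ltr_int R) (le_lt_trans h1)// -pmulrn -[ltRHS]mulr1 ltr_pM2l.
have fm : Num.floor (n%:R * v) = (m j)%:Z.
  by rewrite -vm /shift_index modz_small ?f0// gez0_abs.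
rewrite fm in h1 h2; rewrite intrD in h2.
by rewrite ler_pdivrMr// ler_pdivlMr// (mulrC v) h1 /= -natr1 ltW.
Qed.

Definition shift_indices w : 'I_d -> nat := fun j => shift_index n (tnth (X w) j).

Variable phi : ('I_d -> nat) -> R.
Hypothesis phi0 : forall m, 0 <= phi m.

Lemma shift_indicesE w : phi (shift_indices w) =
  \sum_(m : {ffun 'I_d -> 'I_n}) phi (fun j => m j) *
    \1_(shift_event (fun j => m j)) w.
Proof.
pose m0 : {ffun 'I_d -> 'I_n} :=
  [ffun j => Ordinal (shift_index_lt (tnth (X w) j) n0)].
have m0E : (fun j => m0 j : nat) = shift_indices w.
  by apply/funext => j; rewrite ffunE.
rewrite (bigD1 m0)//= m0E big1 ?addr0 => [|m mm0].
  rewrite indicE mem_set ?mulr1// => j; by [].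
rewrite indicE memNset ?mulr0//= => wm.
move/eqP: mm0; apply; apply/ffunP => j; apply: val_inj.
by rewrite ffunE /=; apply/esym; exact: (wm j).
Qed.

Lemma measurable_shift_indices :
  measurable_fun setT (fun w => phi (shift_indices w)).
Proof.
under eq_fun do rewrite shift_indicesE.
apply: measurable_sum => m; apply: measurable_funM; first exact: measurable_cst.
by apply: measurable_indic; exact: measurable_shift_event.
Qed.

Lemma integral_shift_indices :
  (\int[P]_w (phi (shift_indices w))%:E <=
    (n%:R^-1 ^+ d * \sum_(m : {ffun 'I_d -> 'I_n}) phi (fun j => m j))%:E)%E.
Proof.
have mE m := measurable_shift_event m.
under eq_integral do rewrite shift_indicesE -sumEFin.
rewrite ge0_integral_sum//; last 2 first.
- by move=> m; apply/measurable_EFinP; apply: measurable_funM.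
- by move=> m w _; rewrite lee_fin mulr_ge0// indicE.
rewrite mulr_sumr -sumEFin; apply: lee_sum => m _.
under eq_integral do rewrite EFinM.
rewrite ge0_integralZl//; last 2 first.
- by apply/measurable_EFinP; exact: measurable_indic.
- by rewrite lee_fin.
rewrite integral_indic// setIT mulrC EFinM lee_wpmul2l//.
  by rewrite lee_fin.
exact: prob_shift_event.
Qed.

End shift_expectation.

(** * Quadrature error of a shifted lattice rule *)

Section qmc_error.
Context {R : realType} (d : nat) (lo hi : R).
Hypothesis lohi : lo < hi.

(** The inequality [(a + b)^2 <= 2 (a^2 + b^2)] is used twice: [4 * 2^d] multiplies the discrepancy,
    and [6 = 2 + 4] collects the squared mesh errors of the Riemann sum and of the moved lattice
    points, where [n^-2 <= n^-1]. *)
Definition qmc_cst (M : R) : R := (hi - lo) ^+ d ^+ 2 * M ^+ 2 *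
  (4 * 2 ^+ d + 6 * (d%:R * (hi - lo)) ^+ 2).

Lemma qmc_error n z (shift : 'cV[R]_d) F M : (0 < n)%N -> 0 <= M ->
  mixed_bounded lo hi M F ->
  (cube_integral lo hi F - (hi - lo) ^+ d *
    (n%:R^-1 * (\sum_(1 <= i < n.+1) F (scaled_lattice_point lo hi n z shift i)))) ^+ 2
  <= qmc_cst M *
     (lattice_discrepancy n z (fun j => shift_index n (shift j 0)) + n%:R^-1).
Proof.
move=> n0 M0 hF; set Q := n%:R^-1 * _; set disc := lattice_discrepancy _ _ _.
have nR : 0 < n%:R :> R by rewrite ltr0n.
have h1 := riemann_sum lohi M0 (hF.2) n0.
have h2 := lattice_error lohi z shift n0 M0 hF.
set L := hi - lo in h1 h2 *; set v : R := n%:R^-1.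
have v0 : 0 < v by rewrite invr_gt0.
have v1 : v <= 1 by rewrite invf_le1// ler1n.
have disc0 : 0 <= disc by exact: lattice_discrepancy_ge0.
have L0 : 0 <= L by rewrite subr_ge0 ltW.
set G := grid_mean lo hi n F in h1 h2; set I := cube_integral lo hi F in h1 *.
have -> : I - L ^+ d * Q = (I - L ^+ d * G) + (- (L ^+ d * (Q - G))) by ring.
apply: le_trans (sqrrD_le _ _) _; rewrite sqrrN.
have h3 : (I - L ^+ d * G) ^+ 2 <= (M * (d%:R * (L * v)) * L ^+ d) ^+ 2.
  rewrite -[leLHS]real_normK ?num_real// lerXn2r ?nnegrE//.
  exact: le_trans h1.
have h4 : (L ^+ d * (Q - G)) ^+ 2 <=
    L ^+ d ^+ 2 * (2 * M ^+ 2 * (2 ^+ d * disc + (d%:R * (L * v)) ^+ 2)).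
  by rewrite exprMn ler_wpM2l ?sqr_ge0.
apply: (@le_trans _ _ (2 * ((M * (d%:R * (L * v)) * L ^+ d) ^+ 2 +
  L ^+ d ^+ 2 * (2 * M ^+ 2 * (2 ^+ d * disc + (d%:R * (L * v)) ^+ 2))))).
  by rewrite ler_wpM2l// lerD.
rewrite /qmc_cst -/L -subr_ge0.
have -> : L ^+ d ^+ 2 * M ^+ 2 * (4 * 2 ^+ d + 6 * (d%:R * L) ^+ 2) * (disc + v) -
  2 * ((M * (d%:R * (L * v)) * L ^+ d) ^+ 2 +
    L ^+ d ^+ 2 * (2 * M ^+ 2 * (2 ^+ d * disc + (d%:R * (L * v)) ^+ 2))) =
  L ^+ d ^+ 2 * M ^+ 2 * (4 * 2 ^+ d * v + 6 * (d%:R * L) ^+ 2 * disc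
    + 6 * (d%:R * L) ^+ 2 * (v * (1 - v))) by ring.
apply: mulr_ge0; first by apply: mulr_ge0; exact: sqr_ge0.
have c1 : 0 <= 4 * 2 ^+ d * v by rewrite mulr_ge0 ?(ltW v0)// mulr_ge0 ?exprn_ge0.
have c2 : 0 <= 6 * (d%:R * L) ^+ 2 by rewrite mulr_ge0 ?sqr_ge0.
have c3 : 0 <= v * (1 - v) by rewrite mulr_ge0 ?(ltW v0) ?subr_ge0.
by rewrite !addr_ge0// mulr_ge0.
Qed.

Lemma mean_discrepancy_cbc l (z : 'I_d -> nat) : (0 < d)%N ->
  cbc (2 ^ l) (fun=> 1 : R) z ->
  (2 ^ l)%:R^-1 ^+ d * (\sum_(m : {ffun 'I_d -> 'I_(2 ^ l)})
    lattice_discrepancy (2 ^ l) z (fun j => m j)) <= (7 / 6) ^+ d / (2 ^ l)%:R :> R.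
Proof.
move=> d0 cz; have n0 : (0 < 2 ^ l)%N by rewrite expn_gt0.
apply: le_trans (mean_lattice_discrepancy n0 z) _.
have dm : (d.-1 < d)%N by rewrite prednK.
have := cbc_bound cz (Ordinal dm); rewrite sq_wce1E//= prednK//.
apply: le_trans; rewrite lerD2r ler_wpM2l//.
apply: ler_sum => r _; rewrite [leRHS](eq_bigl predT) => [//|j].
by rewrite -ltnS prednK ?ltn_ord.
Qed.

End qmc_error.

(** * Regularity of the integrands *)

Section smooth_on_Theta.
Context {R : realType} (s k : nat).
Implicit Types (H : 'cV[R]_s -> 'cV[R]_k) (x : 'cV[R]_s).

Let lo : R := - 2^-1.
Let hi : R := 2^-1.

Lemma trmx_continuous m n : continuous (@trmx R m n).
Proof.
move=> A U [P PA PU]; exists (fun i j => P j i) => [i j|B BP].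
  by have := PA j i; rewrite mxE.
by apply: PU => i j; rewrite mxE; exact: BP.
Qed.

Lemma compact_cube n (a b : R) : compact (@cube R n a b).
Proof.
have -> : @cube R n a b = trmx @` [set v : 'rV[R]_n | forall i, `[a, b]%classic (v ord0 i)].
  apply/seteqP; split=> [x xab|_ [v vab <-] j].
    exists x^T; last by rewrite trmxK.
    by move=> i /=; rewrite in_itv /= mxE; exact: xab.
  by have := vab j; rewrite /= in_itv /= mxE.
apply: continuous_compact.
  exact/continuous_subspaceT/trmx_continuous.
apply: (@rV_compact R n (fun=> `[a, b]%classic)) => i.
exact: segment_compact.
Qed.

Lemma coord_cvg (T : Type) (F : set_system T) (f : T -> 'cV[R]_k) (l : 'cV[R]_k) i :
  Filter F -> f @ F --> l -> f x i 0 @[x --> F] --> l i 0.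
Proof.
move=> FF fl; apply: (cvg_comp f (fun A : 'cV[R]_k => A i 0) fl).
exact: coord_continuous.
Qed.

Lemma upd_addE x j v h : upd x j v + h *: delta_mx j 0 = upd x j (v + h).
Proof.
apply/matrixP => i l; rewrite !mxE ord1 eqxx andbT.
by case: eqP => _ /=; rewrite ?mulr1 // mulr0 addr0.
Qed.

Lemma Theta_partial_derive H (i : 'I_k) (j : 'I_s) x :
  {within @Theta R s, continuous H} ->
  (forall j x, Theta x -> cvg (diff_quotient H j x @ Theta_incr j x)) ->
  Theta x ->
  segment_derive lo hi (fun v => H (upd x j v) i 0)
    (fun v => Theta_partial j H (upd x j v) i 0).
Proof.
move=> cH dH Tx; split=> v vI.
  apply: coord_cvg.
  have Tv : Theta (upd x j v) by exact: cube_upd.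
  move/subspace_continuousP : cH => /(_ _ Tv) Hv.
  apply: cvg_trans Hv => U /= UH.
  rewrite !near_simpl.
  move: UH; rewrite !near_withinE => /nbhs_ballP[e /= e0 he].
  apply/nbhs_ballP; exists e => //= w vw; rewrite in_itv /= => wI.
  apply: he; last exact: cube_upd.
  by split=> // a b; rewrite !mxE; case: eqP => _ //; exact: ballxx.
have vI' : lo <= v <= hi by case/andP: vI => *; rewrite !ltW.
have Tv : Theta (upd x j v) by exact: cube_upd.
pose y := upd x j v.
(* Inside the segment small increments stay in the cube, so the limit along [Theta_incr] is the
   ordinary two-sided one. *)
have near_in : \forall h \near 0^', Theta (y + h *: delta_mx j 0).
  have : \forall w \near v, lo <= w <= hi.
    have /near_in_itvoo : v \in `]lo, hi[ by rewrite in_itv.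
    apply: filterS => w; rewrite in_itv /=.
    by move=> /andP[h1 h2]; rewrite !ltW.
  move=> /nbhs_ballP[e /= e0 he].
  apply/nbhs_ballP; exists e => //= h h0 _; rewrite upd_addE.
  apply: cube_upd => //; apply: he; rewrite /ball /= opprD addrA subrr.
  by move: h0; rewrite /ball /=.
have lim0 : diff_quotient H j y @ 0^' --> Theta_partial j H y.
  apply: cvg_trans (dH j y Tv) => U /= hU.
  move: hU; rewrite /nbhs /= /Theta_incr /within /= => hU.
  by apply: filterS2 near_in hU => h Th; apply.
have {}lim0 := @coord_cvg _ _ _ _ i _ lim0.
have lim1 : h^-1 *: (H (upd x j (h *: 1 + v)) i 0 - H (upd x j v) i 0) @[h --> 0^']
    --> Theta_partial j H y i 0.
  under eq_fun => h.
    rewrite (_ : _ *: _ = diff_quotient H j y h i 0); last first.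
      rewrite /diff_quotient upd_addE !mxE /GRing.scale /= mulr1 (addrC h).
      by [].
    over.
  exact: lim0.
apply: DeriveDef; first by apply/cvg_ex; eexists; exact: lim1.
exact/cvg_lim.
Qed.

(** The bounds come from continuity of each iterated derivative on the compact cube. *)
Lemma Theta_smooth_mixedC1 H js ks (i : 'I_k) : Theta_smooth H ->
  mixedC1 lo hi js (fun (_ : unit) x => iter_partial ks H x i 0).
Proof.
move=> sH; elim: js ks => [|j js IH] ks /=.
  have [cH _] := sH ks.
  have : compact (iter_partial ks H @` @Theta R s).
    by apply: continuous_compact => //; exact: compact_cube.
  move=> /compact_bounded[M [_ hM]]; exists (M + 1) => _ x Tx.
  have : `|iter_partial ks H x| <= M + 1 by apply: hM; [rewrite ltrDl|exists x].
  apply: le_trans; rewrite [leRHS]/Num.Def.normr /= mx_normrE.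
  by apply: (le_trans _ (le_bigmax _ _ (i, 0))).
split=> //; exists (fun _ x => iter_partial (j :: ks) H x i 0); split=> //.
have [cH dH] := sH ks.
by move=> _ x; exact: Theta_partial_derive.
Qed.

End smooth_on_Theta.

(** * The Gaussian likelihood *)

Section positive_definite.
Context {R : realType} (k : nat) (Gam : 'M[R]_k).
Hypothesis posdef : sym_posdef Gam.

Lemma sym_posdef_unitmx : Gam \in unitmx.
Proof.
rewrite unitmxE unitfE; apply/negP => /det0P[v v0 vG].
have := posdef.2 v^T; rewrite trmxK vG mul0mx mxE ltxx => h.
suff : false by []; apply: h.
by rewrite -(inj_eq (can_inj (@trmxK _ _ _))) trmxK trmx0.
Qed.

Definition inv_quad (u : 'I_k -> R) : R :=
  \sum_i \sum_j u i * (invmx Gam i j * u j).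

Lemma inv_norm_sqr (v : 'cV[R]_k) :
  inv_norm Gam v ^+ 2 = inv_quad (fun i => v i 0).
Proof.
have uG := sym_posdef_unitmx; rewrite /inv_norm sqr_sqrtr; last first.
  (* In terms of [x] the form is [x^T Gam x], which is nonnegative, so the square cancels the square
     root. *)
  pose x := invmx Gam *m v.
  have -> : v^T *m invmx Gam *m v = x^T *m Gam *m x.
    rewrite /x trmx_mul trmx_inv posdef.1 -!mulmxA; congr (_ *m (_ *m _)).
    by rewrite mulmxA mulmxV// mul1mx.
  have [->|x0] := eqVneq x 0; first by rewrite mulmx0 mxE.
  exact/ltW/posdef.2.
rewrite -mulmxA mxE; apply: eq_bigr => i _; rewrite mxE mxE mulr_sumr.
by apply: eq_bigr.
Qed.

Definition gauss_cst : R := (\det ((2 * pi) *: Gam)) `^ (- 2^-1).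

Lemma gauss_cst_gt0 : 0 < gauss_cst.
Proof.
(* A real power of a nonzero base is an exponential, so it is enough that the determinant does not
   vanish. *)
rewrite /gauss_cst /powR ifF ?expR_gt0//; apply/negbTE.
rewrite detZ mulf_neq0//.
  by rewrite expf_neq0// mulf_neq0// gt_eqF// pi_gt0.
by have := sym_posdef_unitmx; rewrite unitmxE unitfE.
Qed.

Lemma likelihoodE s (G : 'cV[R]_s -> 'cV[R]_k) theta y :
  likelihood Gam G theta y =
  gauss_cst * expR (-1 * (2^-1 * inv_quad (fun i => y i 0 - G theta i 0))).
Proof.
rewrite /likelihood inv_norm_sqr mulN1r; congr (_ * expR (- (_ * inv_quad _))).
by apply/funext => i; rewrite !mxE.
Qed.

(** [u] stands for the residual [y - G theta]. It serves twice: as a function of [theta] with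
    parameter [y], and as a function of [y] with parameter [theta]. *)
Lemma mixedC1_gauss d (lo hi : R) js P (u : 'I_k -> P -> 'cV[R]_d -> R) :
  (forall i, mixedC1 lo hi js (u i)) ->
  mixedC1 lo hi js (fun p x =>
    gauss_cst * expR (-1 * (2^-1 * inv_quad (fun i => u i p x)))) /\
  exists m, 0 < m /\ forall p x, cube lo hi x ->
    m <= gauss_cst * expR (-1 * (2^-1 * inv_quad (fun i => u i p x))).
Proof.
move=> hu; pose cst (c : R) := @mixedC1_cst R d lo hi js P (fun=> c) `|c| (fun=> lexx _).
have hq : mixedC1 lo hi js (fun p x => -1 * (2^-1 * inv_quad (fun i => u i p x))).
  apply: mixedC1M; first exact: cst.
  apply: mixedC1M; first exact: cst.
  apply: mixedC1_sum => i; apply: mixedC1_sum => j.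
  by apply: mixedC1M; [exact: hu|apply: mixedC1M; [exact: cst|exact: hu]].
split; first by apply: mixedC1M; [exact: cst|exact: mixedC1_expR].
have [M M0 hM] := mixedC1_bounded hq.
exists (gauss_cst * expR (- M)); split.
  by rewrite mulr_gt0 ?gauss_cst_gt0 ?expR_gt0.
move=> p x cx; rewrite ler_pM2l ?gauss_cst_gt0// ler_expR.
by have := hM p x cx; rewrite ler_norml => /andP[].
Qed.

End positive_definite.

Lemma xlogx_lipschitz {R : realType} (a b : R) : 0 < a ->
  exists2 L, 0 < L & forall x y, a <= x <= b -> a <= y <= b ->
    `|xlogx y - xlogx x| <= L * `|y - x|.
Proof.
move=> a0; exists (`|ln a| + `|ln b| + 1) => [|x y xI yI].
  by rewrite ltr_wpDl// addr_ge0.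
have d : segment_derive a b (@xlogx R) (fun v => 1 * ln v + v * (v^-1 * 1)).
  apply: (segment_deriveM (segment_derive_id a b)).
  have dln v : a <= v <= b -> is_derive (id v) 1 (@ln R) v^-1.
    by move=> /andP[av _]; exact: is_derive1_ln (lt_le_trans a0 av).
  exact: (@segment_derive_comp _ a b (@ln R) (fun v => v^-1) id (fun=> 1) dln
    (segment_derive_id a b)).
apply: (segment_derive_le d) => // v /andP[av vb].
have v0 : 0 < v := lt_le_trans a0 av.
rewrite mul1r mulr1 divff ?gt_eqF// (le_trans (ler_normD _ _))// normr1 lerD2r.
have h1 : ln a <= ln v by rewrite ler_ln ?posrE.
have h2 : ln v <= ln b by rewrite ler_ln ?posrE// (lt_le_trans v0).
rewrite ler_norml; have := ler_norm (- ln a); have := ler_norm (ln b).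
rewrite normrN; have := normr_ge0 (ln a); have := normr_ge0 (ln b).
by move=> *; apply/andP; split; lra.
Qed.

Import HBNNSimple.

(** The integral of a nonnegative function is the supremum over the simple functions below it, so it
    is monotone without measurability. This allows the squared error to be compared with its
    measurable majorant. *)
Lemma ge0_le_integral_nonmeasurable {d} {T : measurableType d} {R : realType}
    (mu : {measure set T -> \bar R}) (f1 f2 : T -> \bar R) :
  (forall x, 0 <= f1 x)%E -> (forall x, f1 x <= f2 x)%E ->
  (\int[mu]_x f1 x <= \int[mu]_x f2 x)%E.
Proof.
move=> f10 f12; have f20 x : (0 <= f2 x)%E by exact: le_trans (f12 x).
rewrite !ge0_integralTE//; apply: ereal_sup_le => _ [h hf1 <-].
exists h => //= x.
exact: le_trans (hf1 x) (f12 x).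
Qed.

Section likelihood_regularity.
Context {R : realType} (k s : nat) (Gam : 'M[R]_k) (K : R).
Hypothesis posdef : sym_posdef Gam.
Hypothesis K0 : 0 < K.
Variable G : 'cV[R]_s -> 'cV[R]_k.
Hypothesis smooth : Theta_smooth G.

Let f := likelihood Gam G.
Let half0 : - 2^-1 < 2^-1 :> R.
Proof. by rewrite gtrN ?invr_gt0. Qed.

Let KK : - K < K.
Proof. by rewrite gtrN. Qed.

Lemma mixedC1_G i : mixedC1 (- 2^-1) 2^-1 (enum 'I_s) (fun (_ : unit) x => G x i 0).
Proof. exact: (@Theta_smooth_mixedC1 _ _ _ _ _ [::]). Qed.

Lemma likelihood_inner_regular : exists m M M1 : R, [/\ 0 < m, 0 < M1,
  forall y theta, cube (- K) K y -> Theta theta -> m <= f theta y <= M &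
  forall y, cube (- K) K y -> mixed_bounded (- 2^-1) 2^-1 M1 (f^~ y)].
Proof.
pose P := {y : 'cV[R]_k | cube (- K) K y}.
pose u i (p : P) (x : 'cV[R]_s) := sval p i 0 - G x i 0.
have hu i : mixedC1 (- 2^-1) 2^-1 (enum 'I_s) (u i).
  apply: mixedC1D.
    apply: (@mixedC1_cst _ _ _ _ _ _ (fun p : P => sval p i 0) K) => -[y yK] /=.
    by rewrite ler_norml; exact: yK.
  rewrite (_ : (fun p => _) = fun (p : P) x => -1 * G x i 0); last first.
    by apply/funext => p; apply/funext => x; rewrite mulN1r.
  apply: mixedC1M.
    exact: (@mixedC1_cst _ _ _ _ _ _ (fun=> -1) `|-1|).
  exact: (mixedC1_reindex (fun=> tt) (mixedC1_G i)).
have [hF [m [m0 hm]]] := mixedC1_gauss posdef hu.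
have [M M0 hM] := mixedC1_bounded hF.
have [M1 M10 hM1] := mixedC1_mixed_bounded half0 hF.
have fE y (yK : cube (- K) K y) x : f x y = gauss_cst Gam *
    expR (-1 * (2^-1 * inv_quad Gam (fun i => u i (exist _ y yK) x))).
  exact: likelihoodE.
exists m, M, M1; split=> // [y x yK Tx|y yK].
  rewrite (fE _ yK) hm//=; apply: le_trans (ler_norm _) _.
  exact: hM (exist _ y yK) x Tx.
rewrite (_ : f^~ y = fun x => gauss_cst Gam *
    expR (-1 * (2^-1 * inv_quad Gam (fun i => u i (exist _ y yK) x)))); last first.
  by apply/funext => x; exact: fE.
exact: hM1 (exist _ y yK).
Qed.

Let fbar y := cube_integral (- 2^-1) 2^-1 (f^~ y).

Let fN (N : nat) y := grid_mean (- 2^-1) 2^-1 N.+1 (f^~ y).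

Let grid_meanE (N : nat) (F : 'cV[R]_s -> R) : grid_mean (- 2^-1) 2^-1 N.+1 F =
  #|{ffun 'I_s -> 'I_N.+1}|%:R^-1 * \sum_(y : {ffun 'I_s -> 'I_N.+1})
     F (grid_point (- 2^-1) 2^-1 N.+1 (fun j => y j)).
Proof. by rewrite /grid_mean card_ffun !card_ord natrX exprVn. Qed.

Let fN_cvg y : cube (- K) K y -> fN N y @[N --> \oo] --> fbar y.
Proof.
move=> yK; have [m [M [M1 [m0 M10 fb fM]]]] := likelihood_inner_regular.
have h N : `|fbar y - fN N y| <= M1 * s%:R * N.+1%:R^-1.
  have := riemann_sum half0 (ltW M10) (fM _ yK).2 (ltn0Sn N).
  have -> : 2^-1 - - 2^-1 = 1 :> R by lra.
  by rewrite expr1n !mul1r mulr1 mulrA.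
apply/cvgrPdist_le => eps eps0.
have : M1 * s%:R * N.+1%:R^-1 @[N --> \oo] --> M1 * s%:R * 0.
  by apply: cvgMl_tmp; exact: cvg_harmonic.
rewrite mulr0 => /cvgrPdist_le /(_ _ eps0); apply: filterS => N.
rewrite sub0r normrN ger0_norm; last by rewrite mulr_ge0// mulr_ge0// ltW.
exact: le_trans (h N).
Qed.

Let fN_bounds m M : (forall y theta, cube (- K) K y -> Theta theta ->
    m <= f theta y <= M) ->
  forall N y, cube (- K) K y -> m <= fN N y <= M.
Proof.
move=> fb N y yK; rewrite /fN grid_meanE.
have T0 : 0 < #|{ffun 'I_s -> 'I_N.+1}|%:R :> R by rewrite ltr0n card_ffun !card_ord expn_gt0.
have Tg (t : {ffun 'I_s -> 'I_N.+1}) : Theta (grid_point (- 2^-1) 2^-1 N.+1 (fun j => t j) : 'cV[R]_s).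
  by apply: (grid_point_cube half0) => j; exact: ltn_ord.
rewrite ler_pdivlMl// ler_pdivrMl// !mulr_natl -!sumr_const.
by apply/andP; split; apply: ler_sum => t _;
  have /andP[] := fb y _ yK (Tg t).
Qed.

(** The bounds hold for the grid means and pass to the limit, as [Theta] has volume 1. *)
Lemma evidence_bounds m M : (forall y theta, cube (- K) K y -> Theta theta ->
    m <= f theta y <= M) ->
  forall y, cube (- K) K y -> m <= fbar y <= M.
Proof.
move=> fb y yK; have hb N := fN_bounds fb N yK.
apply/andP; split.
  by apply: cvgr_to_ge (fN_cvg yK) _; apply: nearW => N; case/andP: (hb N).
by apply: cvgr_to_le (fN_cvg yK) _; apply: nearW => N; case/andP: (hb N).
Qed.

(* The grid means of the inner integral form a uniformly regular family, so
   no differentiation under the integral sign is needed. *)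
Lemma outer_regular : exists2 M2, 0 < M2 &
  mixed_bounded (- K) K M2 (fun y => xlogx (fbar y)).
Proof.
have [m [M [M1 [m0 M10 fb fM]]]] := likelihood_inner_regular.
pose P := {x : 'cV[R]_s | Theta x}.
pose u i (p : P) (y : 'cV[R]_k) := y i 0 + - G (sval p) i 0.
have hu i : mixedC1 (- K) K (enum 'I_k) (u i).
  apply: mixedC1D; first exact: mixedC1_coord.
  have [B B0 hB] := mixedC1_bounded (mixedC1_G i).
  apply: (@mixedC1_cst _ _ _ _ _ _ (fun p : P => - G (sval p) i 0) B) => -[x Tx].
  by rewrite normrN; exact: (hB tt).
have [hF _] := mixedC1_gauss posdef hu.
have Tg N (t : {ffun 'I_s -> 'I_N.+1}) :
    Theta (grid_point (- 2^-1) 2^-1 N.+1 (fun j => t j) : 'cV[R]_s).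
  by apply: (grid_point_cube half0) => j; exact: ltn_ord.
have hfN : mixedC1 (- K) K (enum 'I_k) fN.
  have := mixedC1_average (T := fun N => {ffun 'I_s -> 'I_N.+1})
    (fun N t => exist _ _ (Tg N t)) hF.
  congr (mixedC1 _ _ _ _); apply/funext => N; apply/funext => y.
  rewrite /fN grid_meanE; congr (_ * _); apply: eq_bigr => t _.
  by rewrite /f likelihoodE.
have fNm N y : cube (- K) K y -> m <= fN N y.
  by move=> yK; have /andP[] := fN_bounds fb N yK.
have hg : mixedC1 (- K) K (enum 'I_k) (fun N y => xlogx (fN N y)).
  by apply: mixedC1M => //; exact: (mixedC1_ln m0).
have [M2 M20 hM2] := mixedC1_mixed_bounded KK hg.
exists M2 => //; apply: (mixed_bounded_cvg KK hM2) => y yK.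
have fb0 : 0 < fbar y.
  by apply: lt_le_trans m0 _; have /andP[] := evidence_bounds fb yK.
apply: cvgM; first exact: fN_cvg.
apply: (cvg_comp _ (@ln R) (fN_cvg yK)); exact: continuous_ln.
Qed.

End likelihood_regularity.

(** * The error of the tensor product rule *)

Section pathwise_error.
Context {R : realType} (k s : nat) (Gam : 'M[R]_k) (K : R).
Hypothesis posdef : sym_posdef Gam.
Hypothesis K0 : 0 < K.
Variable G : 'cV[R]_s -> 'cV[R]_k.
Hypothesis smooth : Theta_smooth G.

Let f := likelihood Gam G.

Lemma Q1E l z (shift : 'cV[R]_k) F : Q1 K l z shift F =
  (K - - K) ^+ k * ((2 ^ l)%:R^-1 * \sum_(1 <= i < (2 ^ l).+1)
    F (scaled_lattice_point (- K) K (2 ^ l) z shift i)).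
Proof.
rewrite /Q1 opprK -mulr2n -[K *+ 2]mulr_natl natrX -mulrA; congr (_ * (_ * _)).
apply: eq_bigr => i _; rewrite /scaled_lattice_point opprK -mulr2n mulr_natl.
by congr F; apply/matrixP => a c; rewrite !mxE.
Qed.

Lemma Q2E l z (shift : 'cV[R]_s) F : Q2 l z shift F =
  (2^-1 - - 2^-1) ^+ s * ((2 ^ l)%:R^-1 * \sum_(1 <= i < (2 ^ l).+1)
    F (scaled_lattice_point (- 2^-1) 2^-1 (2 ^ l) z shift i)).
Proof.
have E : 2^-1 - - 2^-1 = 1 :> R by lra.
rewrite /Q2 E expr1n mul1r natrX; congr (_ * _).
apply: eq_bigr => i _; rewrite /scaled_lattice_point E scale1r.
by congr F; apply/matrixP => a c; rewrite !mxE.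
Qed.

Lemma pathwise_error : exists2 A, 0 < A & forall l z z' shift shift',
  (cube_integral (- K) K (fun y : 'cV[R]_k =>
       xlogx (cube_integral (- 2^-1) 2^-1 (f^~ y)))
   - Q1 K l z shift (fun y => xlogx (Q2 l z' shift' (f^~ y)))) ^+ 2
  <= A * (lattice_discrepancy (2 ^ l) z
             (fun j => shift_index (2 ^ l) (shift j 0))
          + lattice_discrepancy (2 ^ l) z'
             (fun j => shift_index (2 ^ l) (shift' j 0))
          + 2 * (2 ^ l)%:R^-1).
Proof.
have [m [M [M1 [m0 M10 fb fM]]]] := likelihood_inner_regular K posdef smooth.
have [M2 M20 outer] := outer_regular posdef K0 smooth.
have fbb := evidence_bounds posdef smooth fb.
have [L L0 gL] := xlogx_lipschitz M m0.
have half0 : - 2^-1 < 2^-1 :> R by rewrite gtrN ?invr_gt0.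
have KK : - K < K by rewrite gtrN.
pose fbar y := cube_integral (- 2^-1) 2^-1 (f^~ y).
pose A1 := qmc_cst k (- K) K M2; pose A2 := qmc_cst s (- 2^-1) 2^-1 M1.
have A_ge0 d (lo hi M' : R) : 0 <= qmc_cst d lo hi M'.
  apply: mulr_ge0; first by apply: mulr_ge0; exact: sqr_ge0.
  by apply: addr_ge0; apply: mulr_ge0 => //; exact: sqr_ge0.
(* The total weight of the outer rule and the Lipschitz constant of [g], both squared, times the
   constant of the inner rule. *)
pose B := (K - - K) ^+ k ^+ 2 * L ^+ 2 * A2.
have A10 : 0 <= A1 by exact: A_ge0.
have A20 : 0 <= A2 by exact: A_ge0.
have B0 : 0 <= B by apply: mulr_ge0 => //; apply: mulr_ge0; exact: sqr_ge0.
exists (2 * (A1 + B) + 1) => [|l z z' shift shift'].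
  by rewrite ltr_wpDl// mulr_ge0// addr_ge0.
set n := (2 ^ l)%N; have n0 : (0 < n)%N by rewrite expn_gt0.
have nR : 0 < n%:R :> R by rewrite ltr0n.
set e1 := lattice_discrepancy _ z _; set e2 := lattice_discrepancy _ z' _.
have e10 : 0 <= e1 by exact: lattice_discrepancy_ge0.
have e20 : 0 <= e2 by exact: lattice_discrepancy_ge0.
set I := cube_integral _ _ _; set v : R := n%:R^-1.
have v0 : 0 < v by rewrite invr_gt0.
pose q y := Q2 l z' shift' (f^~ y).
have ha : (I - Q1 K l z shift (@xlogx R \o fbar)) ^+ 2 <= A1 * (e1 + v).
  by rewrite Q1E; exact: (qmc_error KK z shift n0 (ltW M20) outer).
have hq y : cube (- K) K y -> (fbar y - q y) ^+ 2 <= A2 * (e2 + v).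
  move=> yK; rewrite /q Q2E.
  exact: (qmc_error half0 z' shift' n0 (ltW M10) (fM _ yK)).
(* The inner rule is an average of values of [f], so it stays in the range on which [g] is
   Lipschitz. *)
have qb y : cube (- K) K y -> m <= q y <= M.
  move=> yK; rewrite /q Q2E (_ : 2^-1 - - 2^-1 = 1); last by lra.
  rewrite expr1n mul1r ler_pdivlMl// ler_pdivrMl//.
  have cst c : n%:R * c = \sum_(1 <= i < n.+1) c :> R.
    by rewrite sumr_const_nat subn1 mulr_natl.
  rewrite !cst; apply/andP; split; apply: ler_sum => i _;
    have /andP[] := fb y _ yK (scaled_lattice_point_cube half0 n z' shift' i);
    by [].
set E := Num.sqrt (A2 * (e2 + v)).
have E0 : 0 <= A2 * (e2 + v) by rewrite mulr_ge0// addr_ge0// ltW.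
have hb : (Q1 K l z shift (@xlogx R \o fbar) - Q1 K l z shift (@xlogx R \o q)) ^+ 2
    <= B * (e2 + v).
  have : `|Q1 K l z shift (@xlogx R \o fbar) - Q1 K l z shift (@xlogx R \o q)| <=
      (K - - K) ^+ k * (L * E).
    rewrite !Q1E -mulrBr -mulrBr -sumrB normrM normrM.
    have KR : 0 <= (K - - K) ^+ k by rewrite exprn_ge0// subr_ge0 ltW.
    rewrite (ger0_norm KR) ler_wpM2l//.
    rewrite normfV normr_nat ler_pdivrMl// (le_trans (ler_norm_sum _ _ _))//.
    have -> : n%:R * (L * E) = \sum_(1 <= i < n.+1) L * E.
      by rewrite sumr_const_nat subn1 mulr_natl.
    apply: ler_sum => i _.
    have yK := scaled_lattice_point_cube KK n z shift i.
    rewrite (le_trans (gL _ _ (qb _ yK) (fbb _ yK)))// ler_wpM2l ?(ltW L0)//.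
    by rewrite -sqrtr_sqr ler_sqrt// hq.
  move=> h; have h0 := le_trans (normr_ge0 _) h.
  rewrite -[leLHS]real_normK ?num_real//.
  apply: (@le_trans _ _ (((K - - K) ^+ k * (L * E)) ^+ 2)).
    by rewrite lerXn2r ?nnegrE.
  by rewrite !exprMn sqr_sqrtr// /B !mulrA.
have -> : I - Q1 K l z shift (fun y => xlogx (Q2 l z' shift' (f^~ y))) =
  (I - Q1 K l z shift (@xlogx R \o fbar)) +
  (Q1 K l z shift (@xlogx R \o fbar) - Q1 K l z shift (@xlogx R \o q)).
  by rewrite subrKA.
apply: le_trans (sqrrD_le _ _) _.
apply: (@le_trans _ _ (2 * (A1 * (e1 + v) + B * (e2 + v)))).
  by rewrite ler_wpM2l// lerD.
rewrite -subr_ge0.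
have -> : (2 * (A1 + B) + 1) * (e1 + e2 + 2 * v) -
  2 * (A1 * (e1 + v) + B * (e2 + v)) =
  2 * (A1 * (e2 + v) + B * (e1 + v)) + (e1 + e2 + 2 * v) by ring.
have v0' := ltW v0.
have h1 : 0 <= A1 * (e2 + v) by rewrite mulr_ge0// addr_ge0.
have h2 : 0 <= B * (e1 + v) by rewrite mulr_ge0// addr_ge0.
by lra.
Qed.

End pathwise_error.

Lemma expectation_discrepancy {dT : measure_display} {T : measurableType dT}
    {R : realType} (P : probability T R) d l z (X : {RV P >-> d.-tuple R}) :
  (0 < d)%N -> cbc (2 ^ l) (fun=> 1 : R) z -> uniform_shift X ->
  let disc := fun w => lattice_discrepancy (2 ^ l) z
    (fun j => shift_index (2 ^ l) (col_of_tuple (X w) j 0)) in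
  measurable_fun setT disc /\
  (\int[P]_w (disc w)%:E <= ((7 / 6) ^+ d / (2 ^ l)%:R)%:E)%E.
Proof.
move=> d0 cz uX disc; have n0 : (0 < 2 ^ l)%N by rewrite expn_gt0.
have discE w : disc w = lattice_discrepancy (2 ^ l) z (shift_indices (2 ^ l) X w).
  rewrite /disc; congr lattice_discrepancy; apply/funext => j.
  by rewrite mxE.
have disc0 m : 0 <= lattice_discrepancy (2 ^ l) z m :> R.
  exact: lattice_discrepancy_ge0.
have -> : disc = fun w => lattice_discrepancy (2 ^ l) z (shift_indices (2 ^ l) X w).
  by apply/funext => w; exact: discE.
split; first exact: measurable_shift_indices.
apply: le_trans (integral_shift_indices n0 uX disc0) _.
by rewrite lee_fin; exact: mean_discrepancy_cbc.
Qed.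

Theorem theorem7p3 (R : realType) (k : nat) (hk : (0 < k)%N)
  (K : R) (hK : 0 < K)
  (q : nat) (Xi : set 'cV[R]_q) (hXi : compact Xi)
  (Gam : 'M[R]_k) (hGam : sym_posdef Gam)
  (mu_min : R) (hmu_min : 0 < mu_min <= 1)
  (hmu_eig : forall a : R, eigenvalue Gam a -> mu_min <= a)
  (C beta : R) (hC : 1 <= C) (hbeta : 1 <= beta)
  (p : R) (hp : 0 < p < 1)
  (b : nat -> R) (hb0 : forall j, 0 <= b j) (hbp : in_lp p b)
  (G : forall s : nat, 'cV[R]_s -> 'cV[R]_q -> 'cV[R]_k)
  (hGsmooth : forall s : nat, (0 < s)%N -> forall xi, Xi xi ->
     Theta_smooth (fun theta => G s theta xi))
  (hGbound : forall s : nat, (0 < s)%N ->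
     forall theta : 'cV[R]_s, Theta theta ->
     forall (nu : 'I_s -> nat) (xi : 'cV[R]_q), Xi xi ->
       enorm (mpartial nu (fun theta' => G s theta' xi) theta)
         <= C * ((mabs nu)`!%:R `^ beta) * mpow b nu)
  (hp_le : p <= Num.min (2 / 3) beta^-1) (hp_ne : p != beta^-1)
  (s : nat) (hs : (0 < s)%N)
  (xi : 'cV[R]_q) (hxi : Xi xi)
  (delta : R) (hdelta : 0 < delta) :
  let f := likelihood Gam (fun theta => G s theta xi) in
  let I_K := cube_integral (- K) K (fun y : 'cV[R]_k =>
               xlogx (cube_integral (- 2^-1) 2^-1 (fun theta => f theta y))) in
  exists (gam : {set 'I_k} -> R) (gam' : {set 'I_s} -> R)
         (z : nat -> 'I_k -> nat) (z' : nat -> 'I_s -> nat) (C' : R),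
    [/\ (forall u, 0 < gam u) /\ (forall u, 0 < gam' u),
        forall l : nat, cbc (2 ^ l) gam (z l) /\ cbc (2 ^ l) gam' (z' l),
        0 < C' &
        forall (l : nat) (d : measure_display) (T : measurableType d)
          (P : probability T R)
          (Delta : {RV P >-> k.-tuple R}) (Delta' : {RV P >-> s.-tuple R}),
          uniform_shift Delta -> uniform_shift Delta' ->
          independent_shifts Delta Delta' ->
          (sqrte 'E_P[(fun w =>
              `|I_K - Q1 K l (z l) (col_of_tuple (Delta w)) (fun y =>
                  xlogx (Q2 l (z' l) (col_of_tuple (Delta' w))
                           (fun theta => f theta y)))| ^+ 2)%R]
           <= (C' * (2 ^+ l) `^ (- 2^-1 + delta))%:E)%E].
Proof.
move=> f I_K; have smooth := hGsmooth s hs xi hxi.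
have [A A0 hA] := pathwise_error hGam hK smooth.
have [z hz] := @choice _ _ (fun l z => cbc (2 ^ l) (fun=> 1 : R) z)
  (fun l => @cbc_exists R k (2 ^ l) (fun=> 1) (expn_gt0 2 l)).
have [z' hz'] := @choice _ _ (fun l z => cbc (2 ^ l) (fun=> 1 : R) z)
  (fun l => @cbc_exists R s (2 ^ l) (fun=> 1) (expn_gt0 2 l)).
(* The bounds on the two mean discrepancies, plus 2 for the mesh terms. *)
pose c : R := A * ((7 / 6) ^+ k + (7 / 6) ^+ s + 2).
have h76 d : 0 <= (7 / 6) ^+ d :> R by rewrite exprn_ge0.
have c0 : 0 < c by rewrite mulr_gt0// ltr_wpDl// addr_ge0.
exists (fun=> 1), (fun=> 1), z, z', (Num.sqrt c).
split=> //; first by rewrite sqrtr_gt0.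
move=> l d T P X Y uX uY _.
have n0 : 0 < (2 ^ l)%:R :> R by rewrite ltr0n expn_gt0.
have [mX iX] := expectation_discrepancy hk (hz l) uX.
have [mY iY] := expectation_discrepancy hs (hz' l) uY.
set e1 := fun w => lattice_discrepancy _ _ _ in mX iX.
set e2 := fun w => lattice_discrepancy _ _ _ in mY iY.
have e10 w : 0 <= e1 w by exact: lattice_discrepancy_ge0.
have e20 w : 0 <= e2 w by exact: lattice_discrepancy_ge0.
pose v : R := (2 ^ l)%:R^-1.
have v0 : 0 <= v by rewrite invr_ge0 ltW.
have E_le : ('E_P[(fun w => `|I_K - Q1 K l (z l) (col_of_tuple (X w)) (fun y =>
      xlogx (Q2 l (z' l) (col_of_tuple (Y w)) (fun theta => f theta y)))| ^+ 2)%R]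
    <= (c * v)%:E)%E.
  rewrite unlock.
  apply: (@le_trans _ _ (\int[P]_w (A%:E * ((e1 w)%:E + (e2 w)%:E + (2 * v)%:E)))%E).
    apply: ge0_le_integral_nonmeasurable => w.
      by rewrite lee_fin sqr_ge0.
    rewrite -!EFinD -EFinM lee_fin real_normK ?num_real//.
  have m1 : measurable_fun setT (fun w => (e1 w)%:E) by exact/measurable_EFinP.
  have m2 : measurable_fun setT (fun w => (e2 w)%:E) by exact/measurable_EFinP.
  have m12 : measurable_fun setT (fun w => (e1 w)%:E + (e2 w)%:E)%E.
    exact: emeasurable_funD.
  rewrite ge0_integralZl//; last 3 first.
  - by apply: emeasurable_funD => //; exact: measurable_cst.
  - by move=> w _; rewrite -!EFinD lee_fin !addr_ge0// mulr_ge0.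
  - by rewrite lee_fin ltW.
  rewrite ge0_integralD//; last 2 first.
  - by move=> w _; rewrite -EFinD lee_fin addr_ge0.
  - by move=> w _; rewrite lee_fin mulr_ge0.
  rewrite ge0_integralD//; last 2 first.
  - by move=> w _; rewrite lee_fin.
  - by move=> w _; rewrite lee_fin.
  rewrite integral_cst// [X in ((2 * v)%:E * X)%E](_ : _ = 1%E) ?mule1; last exact: probability_setT.
  have -> : c * v = A * ((7 / 6) ^+ k * v + (7 / 6) ^+ s * v + 2 * v).
    by rewrite /c; ring.
  rewrite [leRHS]EFinM lee_wpmul2l ?lee_fin ?(ltW A0)// !EFinD.
  by apply: leeD => //; exact: leeD.
apply: le_trans (_ : (sqrte (c * v)%:E <= _)%E).
  by rewrite lee_sqrt// lee_fin mulr_ge0// ltW.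
rewrite /= lee_fin sqrtrM ?(ltW c0)// ler_wpM2l ?sqrtr_ge0//.
(* The rate obtained is -1/2; with a base at least 1, adding [delta] to the exponent only enlarges
   the bound. *)
have n1 : 1 <= 2 ^+ l :> R by rewrite exprn_ege1// ler1n.
apply: (@le_trans _ _ ((2 ^+ l) `^ (- 2^-1))).
  by rewrite powRN powR12_sqrt ?(le_trans ler01)// /v natrX sqrtrV ?(le_trans ler01).
by rewrite ler_powR// lerDl ltW.
Qed.
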